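(* Let $S=S_1\cdots S_n$ be a one-dimensional chain of $n\ge2$ qubits, $\rho$ a state of $S$, and $U$ a unitary acting nontrivially only on two neighboring qubits. Let $\nu=\sin(\min\{e(U),\pi/2\})$. Then $$|E(U\rho U^\dagger)-E(\rho)|\le\frac1{n-1}\min\Big\{8\log2,\ 8\nu\log2+3(1+\nu)\,h\Big(\frac{\nu}{1+\nu}\Big)\Big\}.$$
   Context: Natural logarithms. $h(x)=-x\log x-(1-x)\log(1-x)$ is the binary entropy. $e(U)=\min\{\|H\|_\infty: H=H^\dagger,\ \exists\chi\in\mathbb R,\ e^{-iH}=e^{-i\chi}U\}$. For a state $\sigma_{AB}$, $I(A:B)_\sigma=H(A)_\sigma+H(B)_\sigma-H(AB)_\sigma$ with $H$ the von Neumann entropy. $E(\rho)=\frac1{n-1}\sum_{j=1}^{n-1}I(S_1\cdots S_j:S_{j+1}\cdots S_n)_\rho$. *)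

(* Defs.v *)
From HB Require Import structures.
From mathcomp Require Import all_boot all_order all_algebra.
From mathcomp Require Import complex.
From mathcomp Require Import boolp classical_sets reals topology normedtype sequences exp trigo.

Set Implicit Arguments.
Unset Strict Implicit.
Unset Printing Implicit Defensive.

Import Order.TTheory GRing.Theory Num.Theory.
Import numFieldNormedType.Exports.
Local Open Scope ring_scope.
Local Open Scope classical_set_scope.

Definition adjmx (R : realType) (m n : nat) (A : 'M[R[i]]_(m, n)) : 'M[R[i]]_(n, m) :=
  (map_mx (@conjc R) A)^T.

Definition hermitian (R : realType) (m : nat) (A : 'M[R[i]]_m) : Prop :=
  adjmx A = A.

Definition unitary (R : realType) (m : nat) (U : 'M[R[i]]_m) : Prop :=
  U *m adjmx U = 1%:M.

(* density matrix: Hermitian, positive semidefinite, unit trace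
   (0 <= z in the order of R[i] means z is real and nonnegative) *)
Definition density (R : realType) (m : nat) (rho : 'M[R[i]]_m) : Prop :=
  [/\ hermitian rho,
      (forall v : 'cV[R[i]]_m, 0 <= (adjmx v *m rho *m v) 0 0)
    & \tr rho = 1].

Definition vnorm (R : realType) (m : nat) (v : 'cV[R[i]]_m) : R :=
  Num.sqrt (\sum_(i < m) ((complex.Re (v i 0)) ^+ 2 + (complex.Im (v i 0)) ^+ 2)).

Definition opnorm (R : realType) (m : nat) (A : 'M[R[i]]_m) : R :=
  sup ((fun v : 'cV[R[i]]_m => vnorm (A *m v)) @` [set v : 'cV[R[i]]_m | vnorm v = 1]).

Definition expmx_partial (R : realType) (m : nat) (A : 'M[R[i]]_m) (N : nat)
  : 'M[R[i]]_m :=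
  \sum_(k < N) ((k`!)%:R)^-1 *: A ^+ k.

Definition is_expmx (R : realType) (m : nat) (A M : 'M[R[i]]_m) : Prop :=
  forall i j,
    (fun N => complex.Re (expmx_partial A N i j)) @ \oo --> complex.Re (M i j) /\
    (fun N => complex.Im (expmx_partial A N i j)) @ \oo --> complex.Im (M i j).

Definition egate (R : realType) (m : nat) (U : 'M[R[i]]_m) : R :=
  inf ((@opnorm R m) @` [set H : 'M[R[i]]_m |
         hermitian H /\
         exists chi : R,
           is_expmx ((Complex 0 (-1)) *: H) ((Complex (cos chi) (- sin chi)) *: U)]).

Definition xlnx (R : realType) (x : R) : R := if x == 0 then 0 else x * ln x.

Definition hbin (R : realType) (x : R) : R := - xlnx x - xlnx (1 - x).

Definition eigvals (R : realType) (m : nat) (A : 'M[R[i]]_m) : seq R[i] :=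
  sval (closed_field_poly_normal (char_poly A)).

Definition vN_entropy (R : realType) (m : nat) (A : 'M[R[i]]_m) : R :=
  - \sum_(z <- eigvals A) xlnx (complex.Re z).

(* ---------- qubit chain S_1 ... S_n, Hilbert space dimension 2^n ----------
   Basis index i : 'I_(2^n); qubit S_1 is the most significant bit.        *)

Lemma pidx_proof (n j : nat) (a b : nat) : ((a * 2 ^ (n - j) + b) %% 2 ^ n < 2 ^ n)%N.
Proof. by rewrite ltn_pmod // expn_gt0. Qed.

(* index of |a>_{S_1..S_j} (x) |b>_{S_{j+1}..S_n} (the modulus is the identity
   whenever j <= n) *)
Definition pidx (n j : nat) (a : 'I_(2 ^ j)) (b : 'I_(2 ^ (n - j))) : 'I_(2 ^ n) :=
  Ordinal (pidx_proof n j a b).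

Definition redA (R : realType) (n j : nat) (rho : 'M[R[i]]_(2 ^ n)) : 'M[R[i]]_(2 ^ j) :=
  \matrix_(a, a') \sum_(b < 2 ^ (n - j)) rho (pidx a b) (pidx a' b).

Definition redB (R : realType) (n j : nat) (rho : 'M[R[i]]_(2 ^ n))
  : 'M[R[i]]_(2 ^ (n - j)) :=
  \matrix_(b, b') \sum_(a < 2 ^ j) rho (pidx a b) (pidx a b').

Definition mutinfo (R : realType) (n j : nat) (rho : 'M[R[i]]_(2 ^ n)) : R :=
  vN_entropy (redA j rho) + vN_entropy (redB j rho) - vN_entropy rho.

Definition Echain (R : realType) (n : nat) (rho : 'M[R[i]]_(2 ^ n)) : R :=
  ((n - 1)%N%:R)^-1 * \sum_(1 <= j < n) mutinfo j rho.

(* ---------- two-qubit gate on neighbouring qubits S_{k+1}, S_{k+2} ----------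
   embed2 n k u = I_{2^k} (x) u (x) I_{2^(n-k-2)}   (0 <= k <= n-2)         *)

Lemma mid_proof (x : nat) : (x %% 4 < 4)%N. Proof. by rewrite ltn_pmod. Qed.

Definition midx (n k : nat) (i : 'I_(2 ^ n)) : 'I_4 :=
  Ordinal (mid_proof (i %/ 2 ^ (n - k - 2))%N).

Definition embed2 (R : realType) (n k : nat) (u : 'M[R[i]]_4) : 'M[R[i]]_(2 ^ n) :=
  \matrix_(i, i')
    if ((i %/ 2 ^ (n - k) == i' %/ 2 ^ (n - k)) &&
        (i %% 2 ^ (n - k - 2) == i' %% 2 ^ (n - k - 2)))%N
    then u (midx k i) (midx k i') else 0.

(* Main.v *)
Require Import Defs.
From HB Require Import structures.
From mathcomp Require Import all_boot all_order all_algebra.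
From mathcomp Require Import complex ring lra zify.
From mathcomp Require Import boolp classical_sets reals topology normedtype sequences exp trigo.
Set Implicit Arguments.
Unset Strict Implicit.
Unset Printing Implicit Defensive.
Import Order.TTheory GRing.Theory Num.Theory.
Local Open Scope ring_scope.

(* For every cut other than the one between the two qubits of the gate, U acts on one
   side only and the mutual information is unchanged.  At the remaining cut the
   entropies of both sides, say of A = A0 a with a a qubit of the gate, must be
   compared before and after the gate.  The marginal on A0 is unchanged, whence a
   first bound, as adding a qubit changes the entropy by at most log 2.  For the
   second one, U rho U^* - rho = P - Q with P, Q positive of trace nu: for a pure
   state psi this holds because <psi|U psi> is a convex combination of the points
   exp(-i t_k) with |t_k| <= e(U), and rho is a mixture of pure states.  The two
   decompositions of U rho U^* + Q = rho + P then yield the bound as in the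
   Alicki-Fannes-Winter argument, but only the concavity of the entropy is needed. *)

(** * Adjoints, diagonalization and entropy *)

Section Adjoint.
Variable R : realType.
Local Notation C := R[i].

(** All matrix entropy estimates rest on one inequality: for any factorization [B *m adjmx B] of a
    positive matrix, the sum of [eta] over the squared column norms of [B] is at least its entropy,
    with equality for scaled eigenvectors. Suitable choices of [B] give pinching, the bound for a
    sum of two matrices and both comparisons with a marginal. Entropies are taken of unnormalized
    matrices, since P and Q have trace nu, which may vanish; the traces then enter through [eta]
    alone. The term (1+nu) h(nu/(1+nu)) equals eta(nu) - eta(1+nu), the correction in the
    homogeneous form of concavity for traces 1 and nu. The term 2 nu log 2 is paid in two halves:
    once to pass from P to its marginal on A0, once to return from that common marginal to Q. Each
    side of the cut contains exactly one qubit of the gate and contributes once, so the cut costs at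
    most 4 log 2 and at most 4 nu log 2 + 2(1+nu) h(nu/(1+nu)), which is below the claim. *)

Lemma adjmxE m n (A : 'M[C]_(m, n)) i j : adjmx A i j = conjc (A j i).
Proof. by rewrite !mxE. Qed.

Lemma adjmxK m n (A : 'M[C]_(m, n)) : adjmx (adjmx A) = A.
Proof. by apply/matrixP => i j; rewrite !adjmxE conjcK. Qed.

Lemma adjmxM m n p (A : 'M[C]_(m, n)) (B : 'M[C]_(n, p)) :
  adjmx (A *m B) = adjmx B *m adjmx A.
Proof. by rewrite /adjmx map_mxM trmx_mul. Qed.

Lemma adjmxD m n (A B : 'M[C]_(m, n)) : adjmx (A + B) = adjmx A + adjmx B.
Proof. by rewrite /adjmx map_mxD linearD. Qed.

Lemma adjmxN m n (A : 'M[C]_(m, n)) : adjmx (- A) = - adjmx A.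
Proof. by rewrite /adjmx map_mxN linearN. Qed.

Lemma adjmxZ m n c (A : 'M[C]_(m, n)) : adjmx (c *: A) = conjc c *: adjmx A.
Proof. by apply/matrixP => i j; rewrite !mxE rmorphM. Qed.

Lemma adjmx_diag m (d : 'rV[C]_m) :
  adjmx (diag_mx d) = diag_mx (\row_i conjc (d 0 i)).
Proof.
apply/matrixP => i j; rewrite !mxE rmorphMn /= eq_sym.
by case: eqP => [->|] //=; rewrite !mulr0n.
Qed.

Lemma unitary_adj {m} {U : 'M[C]_m} : unitary U -> adjmx U *m U = 1%:M.
Proof. exact: mulmx1C. Qed.

Lemma normal_spectral m (A : 'M[C]_m) : A *m adjmx A = adjmx A *m A ->
  exists (V : 'M[C]_m) (d : 'rV[C]_m),
    unitary V /\ A = V *m diag_mx d *m adjmx V.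
Proof.
have adjE (B : 'M[C]_m) : (map_mx Num.conj B)^T = adjmx B.
  by apply/matrixP => i j; rewrite !mxE.
move=> nA; have /orthomx_spectralP /= AE : A \is normalmx.
  by apply/normalmxP; rewrite -!map_trmx adjE.
have uS := spectral_unitarymx A.
exists (adjmx (spectralmx A)), (spectral_diag A); split.
  rewrite /unitary adjmxK; apply: mulmx1C.
  by move/unitarymxP: uS; rewrite -!map_trmx adjE.
by rewrite adjmxK -[adjmx _]adjE map_trmx -(invmx_unitary uS).
Qed.

Lemma hermitian_spectral m (A : 'M[C]_m) : adjmx A = A ->
  exists (V : 'M[C]_m) (d : 'I_m -> R),
    unitary V /\ A = V *m diag_mx (\row_i (d i)%:C%C) *m adjmx V.
Proof.
move=> hA; have [|V [d [uV AE]]] := @normal_spectral m A; first by rewrite hA.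
exists V, (fun i => complex.Re (d 0 i)); split=> //.
suff -> : \row_i (complex.Re (d 0 i))%:C%C = d by [].
have dE : diag_mx d = adjmx V *m A *m V.
  by rewrite AE !mulmxA (unitary_adj uV) mul1mx -mulmxA (unitary_adj uV) mulmx1.
have dH : adjmx (diag_mx d) = diag_mx d.
  by rewrite dE !adjmxM adjmxK hA mulmxA.
apply/rowP => i; rewrite mxE.
have := congr1 (fun M : 'M_m => M i i) dH; rewrite adjmxE !mxE eqxx mulr1n.
by case: (d 0 i) => a b /= [] b0; congr (_ +i* _)%C; lra.
Qed.

Definition sqn (z : C) : R := complex.Re z ^+ 2 + complex.Im z ^+ 2.

Lemma sqnE z : z * conjc z = (sqn z)%:C%C.
Proof. by case: z => a b; rewrite /sqn; apply/eqP; rewrite eq_complex /=; apply/andP; split; apply/eqP; ring. Qed.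

Lemma sqn_ge0 z : 0 <= sqn z.
Proof. by rewrite /sqn addr_ge0 // sqr_ge0. Qed.

Lemma sqnM z t : sqn (z * t) = sqn z * sqn t.
Proof. by case: z => a b; case: t => c d; rewrite /sqn /=; ring. Qed.

Lemma sqn_real (x : R) : sqn x%:C%C = x ^+ 2.
Proof. by rewrite /sqn /= expr0n addr0. Qed.

Lemma sqn_eq0 z : sqn z = 0 -> z = 0.
Proof.
case: z => a b; rewrite /sqn /= => /eqP.
by rewrite paddr_eq0 ?sqr_ge0 // !sqrf_eq0 => /andP[/eqP -> /eqP ->].
Qed.

Lemma ReD (x y : C) : complex.Re (x + y) = complex.Re x + complex.Re y.
Proof. by case: x; case: y. Qed.

Lemma Re_sum (I : finType) (P : pred I) (F : I -> C) :
  complex.Re (\sum_(k | P k) F k) = \sum_(k | P k) complex.Re (F k).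
Proof. exact: (big_morph _ ReD). Qed.

Lemma real_sum (I : finType) (P : pred I) (F : I -> R) :
  (\sum_(k | P k) F k)%:C%C = \sum_(k | P k) (F k)%:C%C :> C.
Proof. exact: rmorph_sum. Qed.

Lemma mulmx_adj_diag m n (A : 'M[C]_(m, n)) i :
  (A *m adjmx A) i i = (\sum_k sqn (A i k))%:C%C.
Proof. by rewrite mxE real_sum; apply: eq_bigr => k _; rewrite adjmxE sqnE. Qed.

Lemma mulmx_diag_adj m n (A : 'M[C]_(m, n)) i :
  (adjmx A *m A) i i = (\sum_k sqn (A k i))%:C%C.
Proof. by rewrite mxE real_sum; apply: eq_bigr => k _; rewrite adjmxE mulrC sqnE. Qed.

Definition eta (x : R) : R := - xlnx x.

(** [eigvals] is some chosen list of roots. Uniqueness of the factorization into linear factors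
    makes it a permutation of [d], and the sum does not see the order. *)
Lemma vN_entropy_diag m (V A : 'M[C]_m) (d : 'I_m -> R) :
  unitary V -> A = V *m diag_mx (\row_i (d i)%:C%C) *m adjmx V ->
  vN_entropy A = \sum_i eta (d i).
Proof.
move=> uV AE; rewrite /vN_entropy /eigvals.
case: closed_field_poly_normal => s /= sE.
have cA : char_poly A = \prod_(i < m) ('X - ((d i)%:C%C)%:P).
  set D := diag_mx _ in AE.
  have -> : char_poly A = char_poly D.
    have uVP : map_mx polyC V *m map_mx polyC (adjmx V) = 1%:M.
      by rewrite -map_mxM uV map_mx1.
    rewrite /char_poly /char_poly_mx AE !map_mxM /=.
    set P := map_mx polyC V; set Q := map_mx polyC (adjmx V).
    have -> : 'X%:M - P *m map_mx polyC D *m Q = P *m ('X%:M - map_mx polyC D) *m Q.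
      by rewrite mulmxBr mulmxBl scalar_mxC -(mulmxA _ P) uVP mulmx1.
    by rewrite !det_mulmx mulrC mulrA -det_mulmx (mulmx1C uVP) det1 mul1r.
  rewrite char_poly_trig; last by rewrite /D diag_mx_is_trig.
  by apply: eq_bigr => i _; rewrite !mxE eqxx mulr1n.
have mA := char_poly_monic A.
move: sE; rewrite (eqP mA) scale1r cA.
rewrite -(big_map (fun i => (d i)%:C%C) xpredT (fun z => 'X - z%:P)).
move=> /prod_XsubC_eq sE.
rewrite -(perm_big _ sE) /= big_map -sumrN.
by rewrite -[index_enum _]filter_predT; apply: eq_bigr => i _.
Qed.

End Adjoint.

(** * The function x |-> - x ln x *)

Section EntropyFunction.
Variable R : realType.
Implicit Types x y : R.

Lemma etaE x : eta x = - (x * ln x).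
Proof. by rewrite /eta /xlnx; case: eqP => [->|//]; rewrite mul0r. Qed.

Lemma eta0 : eta (0 : R) = 0. Proof. by rewrite etaE mul0r oppr0. Qed.
Lemma eta1 : eta (1 : R) = 0. Proof. by rewrite etaE ln1 mulr0 oppr0. Qed.

Lemma etaM x y : 0 <= x -> 0 <= y -> eta (x * y) = x * eta y + y * eta x.
Proof.
rewrite !etaE !le_eqVlt => /predU1P[<-|x0]; first by move=> _; rewrite !mul0r; ring.
by move=> /predU1P[<-|y0]; [ring | rewrite lnM ?posrE //; ring].
Qed.

Lemma ln_le_subr1 x : 0 < x -> ln x <= x - 1.
Proof.
move=> x0; rewrite -{1}(subrK 1 x) addrC; apply: le_ln1Dx.
by rewrite ltrBDr addNr.
Qed.

(** The right-hand side is the tangent of [eta] at [t]; concavity is used in this form, with a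
    suitable [t]. *)
Lemma eta_tangent x t : 0 <= x -> 0 < t -> eta x <= - (x * ln t) + t - x.
Proof.
rewrite etaE le_eqVlt => /predU1P[<-|x0] t0.
  rewrite !mul0r; lra.
have := ln_le_subr1 (divr_gt0 t0 x0); rewrite ln_div ?posrE // => h.
have : x * (ln t - ln x) <= x * (t / x - 1) by rewrite ler_pM2l.
rewrite !mulrBr mulrCA divff ?gt_eqF //; lra.
Qed.

(** Weights of total mass below 1 are allowed because the missing mass can be placed at 0, where
    [eta] vanishes. *)
Lemma eta_jensen (I : finType) (d w : I -> R) :
  (forall i, 0 <= d i) -> \sum_i d i <= 1 -> (forall i, 0 <= w i) ->
  \sum_i d i * eta (w i) <= eta (\sum_i d i * w i).
Proof.
move=> d0 d1 w0; set c := \sum_i d i * w i.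
have dw0 i : 0 <= d i * w i by rewrite mulr_ge0.
have c0 : 0 <= c by rewrite sumr_ge0.
move: c0; rewrite le_eqVlt => /predU1P[c0|c0].
  rewrite -c0 eta0 big1 // => i _.
  have /eqP/(psumr_eq0P (fun i _ => dw0 i))/(_ i isT) : c == 0 by rewrite -c0.
  by rewrite etaE mulrN mulrA => ->; rewrite mul0r oppr0.
apply: (@le_trans _ _ (\sum_i (- ln c * (d i * w i) + c * d i - d i * w i))).
  apply: ler_sum => i _; have := ler_wpM2l (d0 i) (eta_tangent (w0 i) c0).
  lra.
rewrite big_split big_split /= sumrN -!mulr_sumr -/c etaE.
have := ler_wpM2l (ltW c0) d1; lra.
Qed.

(** Equal parts are extremal, so the tangent is taken at the total divided by [#|I|]. *)
Lemma eta_sum_le (I : finType) (q : I -> R) : (0 < #|I|)%N ->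
  (forall i, 0 <= q i) ->
  \sum_i eta (q i) <= eta (\sum_i q i) + (\sum_i q i) * ln (#|I|%:R).
Proof.
move=> I0 q0; set c := \sum_i q i.
have N0 : 0 < (#|I|%:R : R) by rewrite ltr0n.
have c0 : 0 <= c by rewrite sumr_ge0.
move: c0; rewrite le_eqVlt => /predU1P[c0|c0].
  rewrite -c0 eta0 mul0r addr0 big1 // => i _.
  have /eqP/(psumr_eq0P (fun i _ => q0 i))/(_ i isT) -> : c == 0 by rewrite -c0.
  by rewrite eta0.
have t0 : 0 < c / #|I|%:R by rewrite divr_gt0.
apply: (@le_trans _ _ (\sum_i (- ln (c / #|I|%:R) * q i + c / #|I|%:R - q i))).
  apply: ler_sum => i _; have := eta_tangent (q0 i) t0; lra.
have tE : \sum_(i : I) c / #|I|%:R = c.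
  rewrite sumr_const -[LHS]mulr_natr; exact/divfK/lt0r_neq0.
rewrite big_split big_split /= tE sumrN -!mulr_sumr -/c ln_div ?posrE // etaE.
lra.
Qed.

(** The assumption x <= w forces x to vanish wherever w does, so the default value of [ln] at 0 is
    always multiplied by 0. *)
Lemma log_sum (I : finType) (x w : I -> R) :
  (forall i, 0 <= x i) -> (forall i, x i <= w i) ->
  (\sum_i x i) * (ln (\sum_i x i) - ln (\sum_i w i))
    <= \sum_i x i * (ln (x i) - ln (w i)).
Proof.
move=> x0 xw; set X := \sum_i x i; set W := \sum_i w i.
have XW : X <= W by apply: ler_sum.
have X0 : 0 <= X by rewrite sumr_ge0.
move: X0; rewrite le_eqVlt => /predU1P[X0|X0].
  rewrite -X0 mul0r big1 // => i _.
  have /eqP/(psumr_eq0P (fun i _ => x0 i))/(_ i isT) -> : X == 0 by rewrite -X0.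
  by rewrite mul0r.
have W0 : 0 < W by exact: lt_le_trans XW.
apply: (@le_trans _ _ (\sum_i (x i * (ln X - ln W) + (x i - (X / W) * w i)))).
  rewrite big_split /= sumrB -mulr_suml -mulr_sumr -/X -/W divfK ?gt_eqF //.
  by rewrite subrr addr0.
apply: ler_sum => i _; move: (x0 i); rewrite le_eqVlt => /predU1P[<-|xi0].
  rewrite !mul0r !add0r oppr_le0 mulr_ge0 ?divr_ge0 ?(ltW X0) ?(ltW W0) //.
  by apply: le_trans (xw i).
have wi0 : 0 < w i by exact: lt_le_trans (xw i).
set u := (X / W) * (w i / x i).
have u0 : 0 < u by rewrite mulr_gt0 ?divr_gt0.
have := ln_le_subr1 u0.
rewrite /u lnM ?posrE ?divr_gt0 // !ln_div ?posrE // -/u => h.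
have : x i * (ln X - ln W + (ln (w i) - ln (x i))) <= x i * (u - 1) by rewrite ler_pM2l.
have -> : x i * (u - 1) = X / W * w i - x i.
  by rewrite /u; field; rewrite !gt_eqF.
lra.
Qed.

Lemma eta_superadditive (I : finType) (x y : I -> R) :
  (forall i, 0 <= x i) -> (forall i, 0 <= y i) ->
  \sum_i eta (x i) + \sum_i eta (y i) +
    (eta (\sum_i x i + \sum_i y i) - eta (\sum_i x i) - eta (\sum_i y i))
  <= \sum_i eta (x i + y i).
Proof.
move=> x0 y0.
have hx := log_sum x0 (fun i => ler_wpDr (y0 i) (lexx (x i))).
have hy := log_sum y0 (fun i => ler_wpDl (x0 i) (lexx (y i))).
move: hx hy; rewrite big_split /= => hx hy.
have -> : \sum_i eta (x i + y i) = \sum_i eta (x i) + \sum_i eta (y i) +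
    \sum_i x i * (ln (x i) - ln (x i + y i)) +
    \sum_i y i * (ln (y i) - ln (x i + y i)).
  by rewrite -!big_split /=; apply: eq_bigr => i _; rewrite !etaE; ring.
by rewrite !etaE; lra.
Qed.

Lemma mul_hbin x : 0 <= x -> (1 + x) * hbin (x / (1 + x)) = eta x - eta (1 + x).
Proof.
move=> x0; have x1 : 0 < 1 + x by lra.
have -> : hbin (x / (1 + x)) = eta (x / (1 + x)) + eta (1 / (1 + x)).
  rewrite /hbin /eta; congr (_ - xlnx _).
  by field; rewrite gt_eqF.
rewrite mulrDr.
have h z : 0 <= z -> (1 + x) * eta (z / (1 + x)) = eta z - (z / (1 + x)) * eta (1 + x).
  move=> z0; have := etaM (divr_ge0 z0 (ltW x1)) (ltW x1).
  by rewrite divfK ?lt0r_neq0 // => ->; ring.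
rewrite !h // eta1; field; exact: lt0r_neq0.
Qed.

Lemma eta_ge0 x : 0 <= x <= 1 -> 0 <= eta x.
Proof.
move=> /andP[x0 x1]; rewrite etaE oppr_ge0 mulr_ge0_le0 //; exact: ln_le0.
Qed.

Lemma hbin_ge0 x : 0 <= x <= 1 -> 0 <= hbin x.
Proof.
move=> /andP[x0 x1]; rewrite /hbin -/(eta x) -/(eta (1 - x)).
by rewrite addr_ge0 // eta_ge0 //; lra.
Qed.

End EntropyFunction.

(** * Entropy of positive semidefinite matrices *)

Section PositiveSemidefinite.
Variable R : realType.
Local Notation C := R[i].

Definition psd m (X : 'M[C]_m) :=
  adjmx X = X /\ forall v : 'cV[C]_m, 0 <= (adjmx v *m X *m v) 0 0.

Lemma psd_gram m p (B : 'M[C]_(m, p)) : psd (B *m adjmx B).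
Proof.
split=> [|v]; first by rewrite adjmxM adjmxK.
have -> : adjmx v *m (B *m adjmx B) *m v = adjmx (adjmx B *m v) *m (adjmx B *m v).
  by rewrite adjmxM adjmxK !mulmxA.
by rewrite mulmx_diag_adj ler0c sumr_ge0 // => k _; exact: sqn_ge0.
Qed.

Lemma psdD m (X Y : 'M[C]_m) : psd X -> psd Y -> psd (X + Y).
Proof.
move=> [hX pX] [hY pY]; split=> [|v]; first by rewrite adjmxD hX hY.
by rewrite mulmxDr mulmxDl mxE addr_ge0.
Qed.

Lemma psdZ m (X : 'M[C]_m) (c : R) : 0 <= c -> psd X -> psd (c%:C%C *: X).
Proof.
move=> c0 [hX pX]; split=> [|v]; first by rewrite adjmxZ conjc_real hX.
by rewrite -scalemxAr -scalemxAl mxE mulr_ge0 // ler0c.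
Qed.

Lemma psd0 m : psd (0 : 'M[C]_m).
Proof.
split=> [|v]; first by apply/matrixP => i j; rewrite !mxE rmorph0.
by rewrite mulmx0 mul0mx mxE.
Qed.

Lemma psd_sum m (I : finType) (F : I -> 'M[C]_m) :
  (forall i, psd (F i)) -> psd (\sum_i F i).
Proof. by move=> pF; elim/big_ind: _ => //; [exact: psd0 | exact: psdD]. Qed.

Lemma psd_conj m p (X : 'M[C]_m) (A : 'M[C]_(p, m)) :
  psd X -> psd (A *m X *m adjmx A).
Proof.
move=> [hX pX]; split=> [|v]; first by rewrite !adjmxM adjmxK hX mulmxA.
by have := pX (adjmx A *m v); rewrite adjmxM adjmxK !mulmxA.
Qed.

Lemma psd_diag m (X : 'M[C]_m) i : psd X -> X i i = (complex.Re (X i i))%:C%C /\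
  0 <= complex.Re (X i i).
Proof.
pose e : 'cV[C]_m := delta_mx i 0.
have eE : adjmx e = delta_mx 0 i.
  by apply/rowP => j; rewrite !mxE andbT /= rmorph_nat.
move=> [_ /(_ e)]; rewrite eE -rowE -colE !mxE.
by case: (X i i) => a b; rewrite lecE /= => /andP[/eqP -> ->].
Qed.

Lemma psd_trace m (X : 'M[C]_m) : psd X -> 0 <= complex.Re (\tr X).
Proof.
by move=> pX; rewrite /mxtrace Re_sum sumr_ge0 // => i _; case: (psd_diag i pX).
Qed.

Lemma psd_spectral m (X : 'M[C]_m) : psd X ->
  exists (V : 'M[C]_m) (w : 'I_m -> R), [/\ unitary V, forall i, 0 <= w i &
    X = V *m diag_mx (\row_i (w i)%:C%C) *m adjmx V].
Proof.
move=> pX; have [V [w [uV XE]]] := hermitian_spectral pX.1.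
exists V, w; split=> // i.
have := psd_conj (adjmx V) pX; rewrite adjmxK XE !mulmxA (unitary_adj uV) mul1mx.
rewrite -mulmxA (unitary_adj uV) mulmx1 => /(psd_diag i)[_].
by rewrite !mxE eqxx mulr1n.
Qed.

Lemma diag_sqrtM m (w : 'I_m -> R) : (forall i, 0 <= w i) ->
  let D := diag_mx (\row_i (Num.sqrt (w i))%:C%C) in
  adjmx D = D /\ D *m D = diag_mx (\row_i (w i)%:C%C) :> 'M[C]_m.
Proof.
move=> w0; rewrite /= adjmx_diag mulmx_diag; split.
  by congr diag_mx; apply/rowP => i; rewrite !mxE conjc_real.
by congr diag_mx; apply/rowP => i; rewrite !mxE -rmorphM /= -expr2 sqr_sqrtr.
Qed.

(** The columns of [B] are the eigenvectors scaled by the square roots of the eigenvalues: the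
    equality case of [vN_entropy_gram]. *)
Lemma psd_gramP m (X : 'M[C]_m) : psd X -> exists B : 'M[C]_m,
  X = B *m adjmx B /\ vN_entropy X = \sum_k eta (\sum_i sqn (B i k)).
Proof.
move=> pX; have [V [w [uV w0 XE]]] := psd_spectral pX.
have [Dh DD] := diag_sqrtM w0; set D := diag_mx _ in Dh DD.
exists (V *m D); split; first by rewrite adjmxM Dh mulmxA -(mulmxA V) DD.
rewrite (vN_entropy_diag uV XE); apply: eq_bigr => k _; congr eta.
apply: complexI; rewrite -mulmx_diag_adj adjmxM Dh mulmxA -(mulmxA D).
by rewrite (unitary_adj uV) mulmx1 DD !mxE eqxx mulr1n.
Qed.

(* A decomposition of a matrix W into rank one terms majorizes its spectrum:
   c_k = sum_i |E_ik|^2 w_i with E having orthonormal rows on the support of W. *)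
Lemma vN_entropy_gram m p (B : 'M[C]_(m, p)) :
  vN_entropy (B *m adjmx B) <= \sum_k eta (\sum_i sqn (B i k)).
Proof.
have [V [w [uV w0 WE]]] := psd_spectral (psd_gram B).
rewrite (vN_entropy_diag uV WE).
have [F FE] : exists F, F = adjmx V *m B by exists (adjmx V *m B).
have FF : F *m adjmx F = diag_mx (\row_i (w i)%:C%C).
  rewrite FE adjmxM adjmxK -mulmxA (mulmxA B) WE -(mulmxA V) mulmxA.
  by rewrite (mulmxA (adjmx V)) (unitary_adj uV) mul1mx -mulmxA (unitary_adj uV) mulmx1.
have wE i : w i = \sum_k sqn (F i k).
  by apply: complexI; rewrite -mulmx_adj_diag FF !mxE eqxx mulr1n.
have F0 i k : w i = 0 -> F i k = 0.
  move=> wi0; apply: sqn_eq0.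
  have /psumr_eq0P := etrans (esym (wE i)) wi0.
  by apply=> // k' _; exact: sqn_ge0.
(* The inverse of 0 is 0, so rows belonging to zero eigenvalues vanish and [E] is a partial
   isometry. *)
pose E : 'M[C]_(m, p) := \matrix_(i, k) (((Num.sqrt (w i))^-1)%:C%C * F i k).
have sE i k : sqn (E i k) = (w i)^-1 * sqn (F i k).
  by rewrite mxE sqnM sqn_real exprVn sqr_sqrtr.
have EEE : E *m adjmx E *m E = E.
  have -> : E = diag_mx (\row_i ((Num.sqrt (w i))^-1)%:C%C) *m F.
    by apply/matrixP => i k; rewrite mul_diag_mx !mxE.
  rewrite adjmxM adjmx_diag mulmxA -(mulmxA _ F) FF -mulmxA (mulmxA _ _ F).
  rewrite !mulmx_diag mulmxA mulmx_diag; apply/matrixP => i k.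
  rewrite !mul_diag_mx !mxE; have [wi0|wi0] := eqVneq (w i) 0.
    by rewrite F0 // !mulr0.
  congr (_ * _); rewrite conjc_real -!rmorphM /=; congr (_%:C)%C.
  rewrite -[in X in _ * X * _](sqr_sqrtr (w0 i)).
  have : Num.sqrt (w i) != 0 by rewrite sqrtr_eq0 -ltNge lt_neqAle eq_sym wi0 w0.
  by move=> h; field.
have E1 k : \sum_i sqn (E i k) <= 1.
  (* [g] is a diagonal entry of the projection [adjmx E *m E]; as the squared norm of its own row it
     satisfies g >= g^2. *)
  set g := \sum_i _; have g0 : 0 <= g by rewrite sumr_ge0 // => i _; exact: sqn_ge0.
  pose G := adjmx E *m E.
  have Gkk : G k k = g%:C%C by rewrite /G mulmx_diag_adj.
  have : g = \sum_j sqn (G k j).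
    apply: complexI; rewrite -mulmx_adj_diag -Gkk /G adjmxM adjmxK.
    by rewrite -!mulmxA (mulmxA E) EEE.
  rewrite (bigD1 k) //= Gkk sqn_real => gE.
  have : 0 <= \sum_(j < p | j != k) sqn (G k j) by rewrite sumr_ge0 // => i _; exact: sqn_ge0.
  case: (leP g 1) => // g1 S0; exfalso.
  have : 0 < g * (g - 1) by rewrite mulr_gt0 ?subr_gt0 // (lt_trans _ g1).
  by rewrite mulrBr mulr1 -expr2; lra.
have cE k : \sum_i sqn (B i k) = \sum_i sqn (E i k) * w i.
  apply: complexI; rewrite -mulmx_diag_adj.
  have -> : adjmx B *m B = adjmx F *m F.
    by rewrite FE adjmxM adjmxK -mulmxA (mulmxA V) uV mul1mx.
  rewrite mulmx_diag_adj; congr (_%:C)%C; apply: eq_bigr => i _; rewrite sE.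
  have [wi0|wi0] := eqVneq (w i) 0; first by rewrite F0 // wi0 !mulr0 /sqn /= !expr0n addr0.
  by rewrite mulrAC mulVf // mul1r.
apply: (@le_trans _ _ (\sum_k \sum_i sqn (E i k) * eta (w i))); last first.
  apply: ler_sum => k _; rewrite cE; apply: eta_jensen => // i; exact: sqn_ge0.
rewrite exchange_big /=; apply: ler_sum => i _; rewrite -mulr_suml.
have [wi0|wi0] := eqVneq (w i) 0; first by rewrite wi0 eta0 mulr0.
under eq_bigr do rewrite sE.
by rewrite -mulr_sumr -wE mulVf // mul1r.
Qed.

(** An arbitrary finite index type lets ensembles be merged over sum types and refined over product
    types. *)
Lemma vN_entropy_ensemble m (K : finType) (W : 'M[C]_m) (b : 'I_m -> K -> C) :
  (forall i j, W i j = \sum_k b i k * conjc (b j k)) ->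
  vN_entropy W <= \sum_k eta (\sum_i sqn (b i k)).
Proof.
move=> WE; pose B : 'M[C]_(m, #|K|) := \matrix_(i, k) b i (enum_val k).
have -> : W = B *m adjmx B.
  apply/matrixP => i j; rewrite WE mxE (reindex _ (onW_bij _ (@enum_val_bij K))) /=.
  by apply: eq_bigr => k _; rewrite adjmxE !mxE.
apply: le_trans (vN_entropy_gram B) _.
rewrite [leRHS](reindex _ (onW_bij _ (@enum_val_bij K))) /=.
by apply: ler_sum => k _; under eq_bigr do rewrite mxE.
Qed.

(** With Q the square root of X, the columns of Q V have the diagonal entries in the basis V as
    squared norms, while (Q V)(Q V)^* is X. *)
Lemma vN_entropy_pinching m (X V : 'M[C]_m) : psd X -> unitary V ->
  vN_entropy X <= \sum_k eta (complex.Re ((adjmx V *m X *m V) k k)).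
Proof.
move=> pX uV; have [Z [w [uZ w0 XE]]] := psd_spectral pX.
have [Dh DD] := diag_sqrtM w0; set D := diag_mx _ in Dh DD.
pose Q := Z *m D *m adjmx Z.
have Qh : adjmx Q = Q by rewrite /Q !adjmxM adjmxK Dh mulmxA.
have QQ : Q *m Q = X.
  rewrite /Q -!mulmxA (mulmxA (adjmx Z) Z) (unitary_adj uZ) mul1mx.
  by rewrite (mulmxA D) DD XE !mulmxA.
have {1}-> : X = Q *m V *m adjmx (Q *m V).
  by rewrite adjmxM Qh mulmxA -(mulmxA Q V) uV mulmx1.
apply: le_trans (vN_entropy_gram _) _; apply: ler_sum => k _.
have -> : adjmx V *m X *m V = adjmx (Q *m V) *m (Q *m V).
  by rewrite -QQ adjmxM Qh !mulmxA.
by rewrite mulmx_diag_adj lexx.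
Qed.

Lemma vN_entropyD_le m (X Y : 'M[C]_m) : psd X -> psd Y ->
  vN_entropy (X + Y) <= vN_entropy X + vN_entropy Y.
Proof.
move=> /psd_gramP[A [-> ->]] /psd_gramP[B [-> ->]].
pose b i (k : 'I_m + 'I_m) := match k with inl k => A i k | inr k => B i k end.
apply: le_trans (vN_entropy_ensemble (b := b) _) _.
  move=> i j; rewrite big_sumType /= !mxE.
  by congr (_ + _); apply: eq_bigr => k _; rewrite adjmxE.
by rewrite big_sumType.
Qed.

(** Concavity of the entropy in homogeneous form: S(X) - eta(tr X) is tr X times the entropy of the
    normalized X. In an eigenbasis of X + Y, pinching X and Y reduces it to the scalar log-sum
    inequality. *)
Lemma vN_entropyD_ge m (X Y : 'M[C]_m) : psd X -> psd Y ->
  vN_entropy X + vN_entropy Y +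
    (eta (complex.Re (\tr X) + complex.Re (\tr Y))
     - eta (complex.Re (\tr X)) - eta (complex.Re (\tr Y)))
    <= vN_entropy (X + Y).
Proof.
move=> pX pY; have [V [w [uV w0 XYE]]] := psd_spectral (psdD pX pY).
rewrite (vN_entropy_diag uV XYE).
pose d (Z : 'M[C]_m) k := complex.Re ((adjmx V *m Z *m V) k k).
have d0 Z : psd Z -> forall k, 0 <= d Z k.
  by move=> /(psd_conj (adjmx V)); rewrite adjmxK => pZ k; case: (psd_diag k pZ).
have trd Z : complex.Re (\tr Z) = \sum_k d Z k.
  by rewrite -Re_sum -/(mxtrace _) mxtrace_mulC mulmxA uV mul1mx.
have wE k : w k = d X k + d Y k.
  have /matrixP/(_ k k) : adjmx V *m X *m V + adjmx V *m Y *m V =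
      diag_mx (\row_i (w i)%:C%C).
    rewrite -mulmxDl -mulmxDr XYE !mulmxA (unitary_adj uV) mul1mx -mulmxA.
    by rewrite (unitary_adj uV) mulmx1.
  rewrite [LHS]mxE /d -ReD => ->.
  by rewrite !mxE eqxx.
under [leRHS]eq_bigr do rewrite wE.
apply: le_trans (eta_superadditive (d0 _ pX) (d0 _ pY)).
by rewrite !trd lerD2r lerD // vN_entropy_pinching.
Qed.

End PositiveSemidefinite.

(** * Partial traces *)

Section PartialTrace.
Variables (R : realType) (M N : nat) (T : finType).
Variables (f : 'I_M * T -> 'I_N) (g : 'I_N -> 'I_M * T).
Hypotheses (fK : cancel f g) (gK : cancel g f).
Local Notation C := R[i].

(** The tensor factorization is given by the bijection [f], so one definition traces out a left or a
    right block, of the chain or of one of its parts. *)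
Definition ptr (X : 'M[C]_N) : 'M[C]_M :=
  \matrix_(i, j) \sum_t X (f (i, t)) (f (j, t)).

(** This is V tensored with the identity on the factor [T]. *)
Definition lift_mx (V : 'M[C]_M) : 'M[C]_N :=
  \matrix_(x, y) (V (g x).1 (g y).1 *+ ((g x).2 == (g y).2)).

Lemma sum_factor (A : nmodType) (F : 'I_N -> A) :
  \sum_x F x = \sum_i \sum_t F (f (i, t)).
Proof.
rewrite pair_big /= (reindex f) /=; last by exists g => x _; rewrite ?fK ?gK.
by apply: eq_bigr => -[].
Qed.

Lemma lift_mulE V (X : 'M[C]_N) i t y :
  (lift_mx V *m X) (f (i, t)) y = \sum_k V i k * X (f (k, t)) y.
Proof.
rewrite mxE sum_factor; apply: eq_bigr => k _; rewrite (bigD1 t) //=.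
rewrite mxE !fK eqxx mulr1n big1 ?addr0 // => s st.
by rewrite mxE !fK /= eq_sym (negPf st) mul0r.
Qed.

Lemma mul_adj_liftE V (X : 'M[C]_N) x j t :
  (X *m adjmx (lift_mx V)) x (f (j, t)) = \sum_k X x (f (k, t)) * conjc (V j k).
Proof.
rewrite mxE sum_factor; apply: eq_bigr => k _; rewrite (bigD1 t) //=.
rewrite adjmxE mxE !fK eqxx mulr1n big1 ?addr0 // => s st.
by rewrite adjmxE mxE !fK /= eq_sym (negPf st) rmorph0 mulr0.
Qed.

Lemma lift_conjE V (X : 'M[C]_N) i t j s :
  (lift_mx V *m X *m adjmx (lift_mx V)) (f (i, t)) (f (j, s)) =
  \sum_l \sum_k V i k * X (f (k, t)) (f (l, s)) * conjc (V j l).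
Proof.
rewrite mul_adj_liftE; apply: eq_bigr => l _.
by rewrite lift_mulE mulr_suml.
Qed.

Lemma unitary_lift V : unitary V -> unitary (lift_mx V).
Proof.
move=> uV; apply/matrixP => x y; rewrite -(gK x) -(gK y).
case: (g x) => i t; case: (g y) => j s.
have : (lift_mx V *m 1%:M *m adjmx (lift_mx V)) (f (i, t)) (f (j, s)) =
    (1%:M : 'M_N) (f (i, t)) (f (j, s)).
  rewrite lift_conjE exchange_big /=.
  transitivity (\sum_k V i k * (k == k)%:R * conjc (V j k) *+ (t == s)).
    apply: eq_bigr => k _; rewrite (bigD1 k) //= mxE (can_eq fK) xpair_eqE eqxx /=.
    rewrite big1 ?addr0 => [|l lk]; first by case: eqP; rewrite ?mulr0 ?mul0r.
    by rewrite mxE (can_eq fK) xpair_eqE eq_sym (negPf lk) /= mulr0 mul0r.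
  rewrite sumrMnl mxE (can_eq fK) xpair_eqE.
  under eq_bigr do rewrite eqxx mulr1.
  case: (t == s); rewrite ?andbT ?andbF ?mulr1n ?mulr0n //.
  have /matrixP/(_ i j) := uV; rewrite mxE [RHS]mxE => <-.
  by apply: eq_bigr => k _; rewrite adjmxE.
by rewrite mulmx1.
Qed.

Lemma ptr_lift V (X : 'M[C]_N) :
  ptr (lift_mx V *m X *m adjmx (lift_mx V)) = V *m ptr X *m adjmx V.
Proof.
apply/matrixP => i j; rewrite mxE [RHS]mxE.
under eq_bigr do rewrite lift_conjE.
rewrite exchange_big /=; apply: eq_bigr => l _.
rewrite exchange_big /= adjmxE mxE mulr_suml; apply: eq_bigr => k _.
by rewrite mxE mulr_sumr mulr_suml.
Qed.

Lemma ptrD (X Y : 'M[C]_N) : ptr (X + Y) = ptr X + ptr Y.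
Proof.
by apply/matrixP => i j; rewrite !mxE -big_split; apply: eq_bigr => t _; rewrite mxE.
Qed.

Lemma tr_ptr (X : 'M[C]_N) : \tr (ptr X) = \tr X.
Proof.
by rewrite /mxtrace [RHS]sum_factor; apply: eq_bigr => i _; rewrite mxE.
Qed.

Lemma psd_ptr (X : 'M[C]_N) : psd X -> psd (ptr X).
Proof.
move=> pX.
(* Kraus form of the partial trace: the matrices select the block with second index [t]. *)
have -> : ptr X = \sum_t (\matrix_(i, x) (f (i, t) == x)%:R) *m X *m
    adjmx (\matrix_(i, x) (f (i, t) == x)%:R).
  apply/matrixP => i j; rewrite mxE summxE; apply: eq_bigr => t _.
  rewrite mxE (bigD1 (f (j, t))) //= big1 ?addr0 => [|x xj]; last first.
    by rewrite adjmxE mxE eq_sym (negPf xj) rmorph0 mulr0.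
  rewrite adjmxE !mxE eqxx rmorph1 mulr1 (bigD1 (f (i, t))) //=.
  rewrite mxE eqxx mul1r big1 ?addr0 // => x xi.
  by rewrite mxE eq_sym (negPf xi) mul0r.
by apply: psd_sum => t; exact: psd_conj.
Qed.

(** X is pinched in the eigenbasis of its marginal times the standard basis of [T]; each marginal
    eigenvalue is thereby split into [#|T|] parts. *)
Lemma vN_entropy_le_ptr (X : 'M[C]_N) : (0 < #|T|)%N -> psd X ->
  vN_entropy X <= vN_entropy (ptr X) + complex.Re (\tr X) * ln (#|T|%:R).
Proof.
move=> T0 pX; have [V [w [uV w0 YE]]] := psd_spectral (psd_ptr pX).
rewrite (vN_entropy_diag uV YE).
have uL := unitary_lift uV.
apply: le_trans (vN_entropy_pinching pX uL) _.
pose q i t := complex.Re ((adjmx (lift_mx V) *m X *m lift_mx V) (f (i, t)) (f (i, t))).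
have q0 i t : 0 <= q i t.
  have := psd_conj (adjmx (lift_mx V)) pX; rewrite adjmxK.
  by move=> /(psd_diag (f (i, t)))[].
have aL : adjmx (lift_mx V) = lift_mx (adjmx V).
  apply/matrixP => x y; rewrite !mxE eq_sym.
  by case: eqP => _; rewrite ?mulr1n ?mulr0n ?rmorph0 ?mxE.
have qw i : \sum_t q i t = w i.
  have := ptr_lift (adjmx V) X; rewrite -aL !adjmxK YE !mulmxA.
  rewrite (unitary_adj uV).
  rewrite mul1mx -[RHS]mulmxA (unitary_adj uV) mulmx1 => /matrixP/(_ i i).
  rewrite !mxE eqxx mulr1n => /(congr1 (@complex.Re R)) /= <-.
  by rewrite Re_sum.
have trX : complex.Re (\tr X) = \sum_i w i.
  rewrite -tr_ptr YE mxtrace_mulC mulmxA (unitary_adj uV) mul1mx mxtrace_diag Re_sum.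
  by apply: eq_bigr => i _; rewrite mxE.
rewrite trX mulr_suml -big_split /= sum_factor; apply: ler_sum => i _.
by rewrite -qw; exact: (eta_sum_le T0 (q0 i)).
Qed.

(** Cutting each scaled eigenvector of X into its blocks indexed by [T] yields an ensemble for the
    marginal, in which each eigenvalue of X is split into [#|T|] parts. *)
Lemma vN_entropy_ptr_le (X : 'M[C]_N) : (0 < #|T|)%N -> psd X ->
  vN_entropy (ptr X) <= vN_entropy X + complex.Re (\tr X) * ln (#|T|%:R).
Proof.
move=> T0 /psd_gramP[B [XE ->]].
apply: le_trans (vN_entropy_ensemble (b := fun i (k : T * 'I_N) => B (f (i, k.1)) k.2) _) _.
  move=> i j; rewrite mxE -(pair_bigA _ (fun t k => B (f (i, t)) k * conjc (B (f (j, t)) k))) /=.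
  by apply: eq_bigr => t _; rewrite XE mxE; apply: eq_bigr => k _; rewrite adjmxE.
rewrite -(pair_bigA _ (fun t k => eta (\sum_i sqn (B (f (i, t)) k)))) /= exchange_big /=.
have -> : complex.Re (\tr X) = \sum_k \sum_x sqn (B x k).
  rewrite XE mxtrace_mulC Re_sum; apply: eq_bigr => k _.
  by rewrite mulmx_diag_adj.
rewrite mulr_suml -big_split /=; apply: ler_sum => k _.
rewrite sum_factor exchange_big /=; apply: eta_sum_le => // t.
by rewrite sumr_ge0 // => i _; exact: sqn_ge0.
Qed.

(* Alicki-Fannes-Winter argument. Since rho and sigma have the same marginal, so do
   P and Q, and plain concavity replaces concavity of the conditional entropy. *)
Lemma vN_entropy_continuity (rho sigma P Q : 'M[C]_N) (nu : R) :
  (0 < #|T|)%N -> psd rho -> psd sigma -> psd P -> psd Q ->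
  sigma + Q = rho + P -> complex.Re (\tr sigma) = 1 ->
  complex.Re (\tr P) = nu -> complex.Re (\tr Q) = nu ->
  ptr rho = ptr sigma ->
  vN_entropy sigma - vN_entropy rho <=
    2 * nu * ln (#|T|%:R) + (1 + nu) * hbin (nu / (1 + nu)).
Proof.
move=> T0 pr ps pP pQ E ts tP tQ mE.
have mPQ : ptr P = ptr Q.
  have : ptr sigma + ptr Q = ptr rho + ptr P by rewrite -!ptrD E.
  by rewrite mE => /addrI.
have nu0 : 0 <= nu by rewrite -tP; exact: psd_trace.
(* By [E] the same entropy is bounded above through rho + P and below through sigma + Q. *)
have h1 := vN_entropyD_le pr pP; rewrite -E in h1.
have h2 := vN_entropyD_ge ps pQ; rewrite ts tQ eta1 in h2.
have h3 := vN_entropy_le_ptr T0 pP; rewrite tP in h3.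
have h4 := vN_entropy_ptr_le T0 pQ; rewrite tQ -mPQ in h4.
rewrite mul_hbin //; move: h1 h2 h3 h4; clear.
move: (vN_entropy (sigma + Q)) (vN_entropy (ptr P)) => a b.
move: (vN_entropy sigma) (vN_entropy rho) (vN_entropy P) (vN_entropy Q) => s r p q.
move: (eta nu) (eta (1 + nu)) (ln #|T|%:R) => c d l; lra.
Qed.

Lemma vN_entropy_marginal (rho sigma : 'M[C]_N) :
  (0 < #|T|)%N -> psd rho -> psd sigma ->
  complex.Re (\tr rho) = 1 -> complex.Re (\tr sigma) = 1 -> ptr rho = ptr sigma ->
  vN_entropy sigma - vN_entropy rho <= 2 * ln (#|T|%:R).
Proof.
move=> T0 pr ps tr ts mE.
have := vN_entropy_le_ptr T0 ps; have := vN_entropy_ptr_le T0 pr.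
rewrite tr ts mE; clear.
move: (vN_entropy (ptr sigma)) (vN_entropy sigma) (vN_entropy rho) => a s r.
move: (ln #|T|%:R) => l; lra.
Qed.

End PartialTrace.

(** [F] exchanges the factors, so the factor traced out is the one on which V acts and V^* V = 1
    collapses the sum. *)
Lemma ptr_lift_other (R : realType) (M L N : nat) (f : 'I_M * 'I_L -> 'I_N)
    (g : 'I_N -> 'I_M * 'I_L) (fK : cancel f g) (gK : cancel g f)
    (V : 'M[R[i]]_M) (X : 'M[R[i]]_N) : unitary V ->
  let F := fun p : 'I_L * 'I_M => f (p.2, p.1) in
  ptr F (lift_mx g V *m X *m adjmx (lift_mx g V)) = ptr F X.
Proof.
move=> uV /=; apply/matrixP => t s; rewrite !mxE /=.
under eq_bigr do rewrite (lift_conjE fK gK).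
rewrite exchange_big /=; apply: eq_bigr => l _.
rewrite exchange_big /= (bigD1 l) //= [X in _ + X]big1 ?addr0 => [|k kl].
  have /matrixP/(_ l l) := unitary_adj uV; rewrite [RHS]mxE eqxx mulr1n mxE => h.
  rewrite -[RHS]mul1r -h mulr_suml; apply: eq_bigr => i _.
  by rewrite adjmxE; ring.
have /matrixP/(_ l k) := unitary_adj uV; rewrite [RHS]mxE eq_sym (negPf kl) mulr0n mxE => h.
rewrite -[RHS](mul0r (X (f (k, t)) (f (l, s)))) -[X in X * _]h mulr_suml.
by apply: eq_bigr => i _; rewrite adjmxE; ring.
Qed.

(** * Trace distance between a state and its image *)

Section TraceDistance.
Variable R : realType.
Local Notation C := R[i].

Lemma psd_hermitian_sqr m (M : 'M[C]_m) (s : R) : 0 < s -> adjmx M = M ->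
  M *m M = s%:C%C *: M -> psd M.
Proof.
move=> s0 hM MM.
have -> : M = (s^-1)%:C%C *: (M *m adjmx M).
  by rewrite hM MM scalerA -rmorphM mulVf ?gt_eqF // scale1r.
by apply: psdZ; [rewrite invr_ge0 ltW | exact: psd_gram].
Qed.

(* The Jordan parts of a matrix with spectrum in {-s, 0, s} are (M^2/s +- M)/2. *)
Lemma cubic_jordan m (M : 'M[C]_m) (s : R) : 0 <= s -> adjmx M = M ->
  M *m M *m M = (s ^+ 2)%:C%C *: M -> \tr M = 0 ->
  \tr (M *m M) = (2 * s ^+ 2)%:C%C ->
  exists P Q, [/\ psd P, psd Q, complex.Re (\tr P) = s, complex.Re (\tr Q) = s
    & P - Q = M].
Proof.
rewrite le_eqVlt => /predU1P[<-|s0] hM M3 t1 t2.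
  (* For s = 0 the trace of M M^*, which is the sum of all squared moduli of entries, vanishes. *)
  have M0 : M = 0.
    apply/matrixP => i j; rewrite [RHS]mxE; apply: sqn_eq0.
    have S0 : \sum_i \sum_j sqn (M i j) = 0.
      apply: complexI; rewrite real_sum.
      rewrite expr0n mulr0 -{2}hM in t2; rewrite -[RHS]t2.
      by apply: eq_bigr => k _; rewrite mulmx_adj_diag.
    have /psumr_eq0P h1 := S0.
    have /psumr_eq0P := h1 (fun i _ => sumr_ge0 _ (fun j _ => sqn_ge0 (M i j))) i isT.
    by apply=> // k _; exact: sqn_ge0.
  by exists 0, 0; rewrite M0 subrr mxtrace0; split=> //; exact: psd0.
pose a : C := (2^-1 * s^-1)%:C%C; pose b : C := (2^-1)%:C%C.
have s1 : s != 0 by rewrite gt_eqF.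
have M4 : M *m M *m (M *m M) = (s ^+ 2)%:C%C *: (M *m M).
  by rewrite mulmxA M3 scalemxAl.
have M3' : M *m (M *m M) = (s ^+ 2)%:C%C *: M by rewrite mulmxA.
pose J (e : R) := a *: (M *m M) + (e%:C%C * b) *: M.
(* [J e] is s times the spectral projection of M for the eigenvalue e s, hence its square is s times
   itself. *)
have JJ e : e ^+ 2 = 1 -> psd (J e).
  move=> e2; apply: (psd_hermitian_sqr s0).
    have ca : conjc a = a by exact: conjc_real.
    have cb : conjc (e%:C%C * b) = e%:C%C * b by rewrite -rmorphM; exact: conjc_real.
    by rewrite /J adjmxD !adjmxZ adjmxM hM ca cb.
  rewrite /J mulmxDl !mulmxDr -!scalemxAl -!scalemxAr M4 M3 M3' !scalerA.
  set MM := M *m M; clearbody MM.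
  have e1 : e%:C%C * e%:C%C = 1 :> C by rewrite -rmorphM -expr2 e2.
  have as1 : s%:C%C * a = b :> C.
    by rewrite /a /b -rmorphM /=; congr (_%:C)%C; field.
  have ab : a * (s ^+ 2)%:C%C = b * s%:C%C :> C.
    by rewrite /a /b -!rmorphM /=; congr (_%:C)%C; field.
  have bb : b * 2 = 1 :> C.
    by rewrite /b -(rmorph_nat (real_complex R)) -rmorphM mulVf // pnatr_eq0.
  apply/matrixP => i j; rewrite !mxE.
  have -> : a * a * (s ^+ 2)%:C%C = b * b :> C.
    by rewrite -mulrA ab mulrCA mulrC -mulrA -as1; ring.
  ring: e1 as1 ab bb.
have J1 : psd (J 1) by apply: JJ; rewrite expr1n.
have JN1 : psd (J (- 1)) by apply: JJ; rewrite sqrrN expr1n.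
have trJ e : complex.Re (\tr (J e)) = s.
  rewrite /J mxtraceD !mxtraceZ t1 t2 mulr0 addr0 /a -rmorphM /=; field.
  exact: s1.
exists (J 1), (J (- 1)); split=> //.
rewrite /J; set MM := M *m M; clearbody MM.
apply/matrixP => i j; rewrite !mxE.
have bb : b * 2 = 1 :> C.
  by rewrite /b -(rmorph_nat (real_complex R)) -rmorphM mulVf // pnatr_eq0.
have -> : (- 1)%:C%C = - 1 :> C by rewrite rmorphN rmorph1.
rewrite rmorph1; ring: bb.
Qed.

Lemma sub_proj_sqr m (A B : 'M[C]_m) : A *m A = A -> B *m B = B ->
  (A - B) *m (A - B) = A - A *m B - B *m A + B.
Proof.
move=> AA BB; rewrite mulmxBl !mulmxBr AA BB; move: (A *m B) (B *m A) => X Y.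
by apply/matrixP => i j; rewrite !mxE; ring.
Qed.

(** For two rank one projections, c is the squared overlap; the cubic relation is what
    [cubic_jordan] asks for, with s^2 = 1 - c. *)
Lemma sub_proj_cube m (A B : 'M[C]_m) (c : C) : A *m A = A -> B *m B = B ->
  A *m B *m A = c *: A -> B *m A *m B = c *: B ->
  (A - B) *m (A - B) *m (A - B) = (1 - c) *: (A - B).
Proof.
move=> AA BB ABA BAB; rewrite sub_proj_sqr // mulmxBr !(mulmxDl, mulNmx).
rewrite ABA BAB -(mulmxA A B B) -(mulmxA B A A) AA BB.
move: (A *m B) (B *m A) => X Y.
by apply/matrixP => i j; rewrite !mxE; ring.
Qed.

(** Padding both Jordan parts by the same matrix keeps their difference and raises both traces to
    exactly nu. As nu does not depend on the pure state, mixtures keep this trace. *)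
Lemma add_slack m (X B : 'M[C]_m) (s nu : R) : psd X -> psd B -> \tr B = 1 ->
  s <= nu -> complex.Re (\tr X) = s ->
  psd (X + (nu - s)%:C%C *: B) /\ complex.Re (\tr (X + (nu - s)%:C%C *: B)) = nu.
Proof.
move=> pX pB trB snu tX; split.
  by apply: psdD => //; apply: psdZ => //; rewrite subr_ge0.
by rewrite mxtraceD mxtraceZ trB mulr1 ReD tX /= addrC subrK.
Qed.

Lemma pure_decomposition m (U : 'M[C]_m) (psi : 'cV[C]_m) (nu : R) :
  unitary U -> adjmx psi *m psi = 1%:M -> 0 <= nu ->
  1 - sqn ((adjmx psi *m U *m psi) 0 0) <= nu ^+ 2 ->
  let A := psi *m adjmx psi in
  exists P Q, [/\ psd P, psd Q, complex.Re (\tr P) = nu, complex.Re (\tr Q) = nu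
    & U *m A *m adjmx U + Q = A + P].
Proof.
move=> uU psi1 nu0 hnu B; pose phi := U *m psi.
pose A := phi *m adjmx phi.
have -> : U *m B *m adjmx U = A by rewrite /A /phi /B adjmxM !mulmxA.
have phi1 : adjmx phi *m phi = 1%:M.
  by rewrite /phi adjmxM -mulmxA (mulmxA _ U) (unitary_adj uU) mul1mx.
set z := (adjmx psi *m U *m psi) 0 0 in hnu.
have zE : adjmx psi *m phi = z%:M by rewrite /phi mulmxA [LHS]mx11_scalar.
have zE' : adjmx phi *m psi = (conjc z)%:M.
  rewrite -[LHS]adjmxK adjmxM adjmxK zE; apply/matrixP => i j.
  by rewrite !ord1 adjmxE !mxE.
have AA : A *m A = A by rewrite /A -mulmxA (mulmxA _ phi) phi1 mul1mx.
have BB : B *m B = B by rewrite /B -mulmxA (mulmxA _ psi) psi1 mul1mx.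
have AB : A *m B = conjc z *: (phi *m adjmx psi).
  by rewrite /A /B -mulmxA (mulmxA _ psi) zE' mul_scalar_mx -scalemxAr.
have BA : B *m A = z *: (psi *m adjmx phi).
  by rewrite /A /B -mulmxA (mulmxA _ phi) zE mul_scalar_mx -scalemxAr.
have ABA : A *m B *m A = (sqn z)%:C%C *: A.
  rewrite AB /A -scalemxAl -mulmxA (mulmxA _ phi) zE mul_scalar_mx -scalemxAr.
  by rewrite scalerA mulrC sqnE.
have BAB : B *m A *m B = (sqn z)%:C%C *: B.
  rewrite BA /B -scalemxAl -mulmxA (mulmxA _ psi) zE' mul_scalar_mx -scalemxAr.
  by rewrite scalerA sqnE.
have trA : \tr A = 1 by rewrite mxtrace_mulC phi1 mxtrace1.
have trB : \tr B = 1 by rewrite mxtrace_mulC psi1 mxtrace1.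
have trAB : \tr (A *m B) = (sqn z)%:C%C.
  by rewrite AB mxtraceZ mxtrace_mulC zE mxtrace_scalar mulr1n mulrC sqnE.
have trBA : \tr (B *m A) = (sqn z)%:C%C by rewrite mxtrace_mulC.
pose M := A - B.
have hA : adjmx A = A by rewrite /A adjmxM adjmxK.
have hB : adjmx B = B by rewrite /B adjmxM adjmxK.
have hM : adjmx M = M by rewrite /M adjmxD adjmxN hA hB.
have trMM : \tr (M *m M) = (2 * (1 - sqn z))%:C%C.
  rewrite sub_proj_sqr // !mxtraceD !linearN /= trA trB trAB trBA.
  rewrite rmorphM rmorphB rmorph_nat rmorph1; ring.
have z1 : 0 <= 1 - sqn z.
  have : (0 : C) <= \tr (M *m M).
    rewrite -{2}hM; apply: sumr_ge0 => i _; rewrite mulmx_adj_diag ler0c.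
    by rewrite sumr_ge0 // => j _; exact: sqn_ge0.
  by rewrite trMM ler0c; lra.
pose s := Num.sqrt (1 - sqn z).
have s2 : s ^+ 2 = 1 - sqn z by rewrite sqr_sqrtr.
have [|||||P [Q [pP pQ tP tQ PQ]]] := @cubic_jordan _ M s.
- exact: sqrtr_ge0.
- exact: hM.
- by rewrite s2 rmorphB rmorph1; exact: sub_proj_cube.
- by rewrite /M mxtraceD linearN /= trA trB subrr.
- by rewrite trMM s2.
have snu : s <= nu by rewrite -(ger0_norm nu0) -sqrtr_sqr ler_sqrt // sqr_ge0.
have pB : psd B by exact: psd_gram.
have [pP' tP'] := add_slack pP pB trB snu tP.
have [pQ' tQ'] := add_slack pQ pB trB snu tQ.
exists (P + (nu - s)%:C%C *: B), (Q + (nu - s)%:C%C *: B); split=> //.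
rewrite !addrA; congr (_ + _); apply/eqP; rewrite -subr_eq0.
by rewrite opprD addrACA -[Q - P]opprB PQ subrr.
Qed.

Lemma mixed_decomposition m (U rho : 'M[C]_m) (nu : R) :
  unitary U -> psd rho -> complex.Re (\tr rho) = 1 -> 0 <= nu ->
  (forall psi : 'cV[C]_m, adjmx psi *m psi = 1%:M ->
     1 - sqn ((adjmx psi *m U *m psi) 0 0) <= nu ^+ 2) ->
  exists P Q, [/\ psd P, psd Q, complex.Re (\tr P) = nu, complex.Re (\tr Q) = nu
    & U *m rho *m adjmx U + Q = rho + P].
Proof.
move=> uU prho trho nu0 hU; have [V [w [uV w0 rE]]] := psd_spectral prho.
pose A i := col i V *m adjmx (col i V).
have c1 i : adjmx (col i V) *m col i V = 1%:M.
  apply/matrixP => x y; rewrite !ord1.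
  have /matrixP/(_ i i) := unitary_adj uV; rewrite mxE [RHS]mxE eqxx => h.
  by rewrite mxE [RHS]mxE -[RHS]h; apply: eq_bigr => k _; rewrite !adjmxE !mxE.
have rS : rho = \sum_i (w i)%:C%C *: A i.
  rewrite rE; apply/matrixP => x y; rewrite summxE mxE; apply: eq_bigr => i _.
  by rewrite mul_mx_diag adjmxE !mxE big_ord1 adjmxE !mxE mulrAC mulrC mulrA.
have w1 : \sum_i w i = 1.
  rewrite -trho rE mxtrace_mulC mulmxA (unitary_adj uV) mul1mx mxtrace_diag Re_sum.
  by apply: eq_bigr => i _; rewrite mxE.
have /fin_all_exists[PQ hPQ] : forall i, exists PQ : 'M[C]_m * 'M[C]_m,
    [/\ psd PQ.1, psd PQ.2, complex.Re (\tr PQ.1) = nu, complex.Re (\tr PQ.2) = nu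
    & U *m A i *m adjmx U + PQ.2 = A i + PQ.1].
  move=> i; have [P [Q h]] := pure_decomposition uU (c1 i) nu0 (hU _ (c1 i)).
  by exists (P, Q).
have trS (F : 'I_m -> 'M[C]_m) : (forall i, complex.Re (\tr (F i)) = nu) ->
    complex.Re (\tr (\sum_i (w i)%:C%C *: F i)) = nu.
  move=> hF; have -> : \tr (\sum_i (w i)%:C%C *: F i) = \sum_i (w i)%:C%C * \tr (F i).
    by rewrite raddf_sum; apply: eq_bigr => i _; exact: mxtraceZ.
  rewrite Re_sum -[RHS]mul1r -w1 mulr_suml; apply: eq_bigr => i _; rewrite -(hF i).
  by case: (\tr (F i)) => x y /=; rewrite mul0r subr0.
exists (\sum_i (w i)%:C%C *: (PQ i).1), (\sum_i (w i)%:C%C *: (PQ i).2); split.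
- by apply: psd_sum => i; apply: psdZ => //; case: (hPQ i).
- by apply: psd_sum => i; apply: psdZ => //; case: (hPQ i).
- by apply: trS => i; case: (hPQ i).
- by apply: trS => i; case: (hPQ i).
rewrite rS mulmx_sumr mulmx_suml -!big_split; apply: eq_bigr => i _ /=.
rewrite -scalemxAr -scalemxAl -!scalerDr.
by case: (hPQ i) => _ _ _ _ ->.
Qed.

End TraceDistance.

(** * Gate energy and numerical range *)

Section GateEnergy.
Import numFieldNormedType.Exports.
Variable R : realType.
Local Notation C := R[i].

Definition cis (t : R) : C := Complex (cos t) (- sin t).

Lemma sqn_cis t : sqn (cis t) = 1.
Proof. by rewrite /sqn /= sqrrN cos2Dsin2. Qed.

Lemma cis_surj (z : C) : sqn z = 1 -> exists t, z = cis t.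
Proof.
case: z => a b; rewrite /sqn /= => ab.
have a1 : -1 <= a <= 1.
  by rewrite -ler_norml -(expr_le1 (n := 2)) // real_normK ?num_real //; have := sqr_ge0 b; lra.
have sE : sin (acos a) = `|b|.
  by rewrite sin_acos // -ab addrAC subrr add0r sqrtr_sqr.
have [b0|b0] := leP b 0.
  by exists (acos a); rewrite /cis acosK // sE ler0_norm // opprK.
exists (- acos a); rewrite /cis cosN sinN acosK // sE gtr0_norm //.
by rewrite opprK.
Qed.

(** The shape follows [cos_coeff] and [sin_coeff]; at k = 0 the truncated predecessor is multiplied
    by 0. *)
Lemma expNi k : (Complex 0 (-1) : C) ^+ k =
  Complex ((~~ odd k)%:R * (-1) ^+ k./2) (- ((odd k)%:R * (-1) ^+ k.-1./2)).
Proof.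
have i2 : (Complex 0 (-1) : C) ^+ 2 = - 1.
  by apply/eqP; rewrite expr2 eq_complex /= !(mul0r, mulr0, mulrNN) sub0r addr0 oppr0 mulr1 !eqxx.
have ev m : (Complex 0 (-1) : C) ^+ m.*2 = Complex ((-1) ^+ m) 0.
  rewrite -mul2n exprM i2.
  by rewrite -[Complex _ _]/(((-1) ^+ m)%:C%C) rmorphXn rmorphN rmorph1.
rewrite -[in LHS](odd_double_half k); case: (boolP (odd k)) => ok /=.
  rewrite exprD expr1 ev; have -> : k.-1./2 = k./2.
    by rewrite -{1}(odd_double_half k) ok /= doubleK.
  by apply/eqP; rewrite eq_complex /=; apply/andP; split; apply/eqP; ring.
by rewrite add0n ev mul1r mul0r oppr0.
Qed.

Lemma exp_coeffNi (t : R) k :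
  (k`!%:R)^-1 * (Complex 0 (-1) * t%:C%C) ^+ k =
  Complex (cos_coeff t k) (- sin_coeff t k).
Proof.
have -> : (k`!%:R)^-1 = ((k`!%:R)^-1)%:C%C :> C by rewrite fmorphV rmorph_nat.
rewrite exprMn expNi -rmorphXn /= /cos_coeff /sin_coeff /=.
apply/eqP; rewrite eq_complex /= !(mul0r, mulr0, subr0, addr0, add0r).
by apply/andP; split; apply/eqP; rewrite ?exprnP; ring.
Qed.

Definition cis_partial (t : R) N : C :=
  \sum_(k < N) (k`!%:R)^-1 * (Complex 0 (-1) * t%:C%C) ^+ k.

Lemma cvg_cis_partial (t : R) :
  ((fun N => complex.Re (cis_partial t N)) @ \oo --> complex.Re (cis t))%classic /\
  ((fun N => complex.Im (cis_partial t N)) @ \oo --> complex.Im (cis t))%classic.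
Proof.
have -> : (fun N => complex.Re (cis_partial t N)) = series (cos_coeff t).
  apply/funext => N; rewrite /cis_partial Re_sum /series /= big_mkord.
  by apply: eq_bigr => k _; rewrite exp_coeffNi.
have -> : (fun N => complex.Im (cis_partial t N)) = (fun N => - series (sin_coeff t) N).
  have ImD : {morph (@complex.Im R) : x y / x + y} by case=> ? ? [].
  apply/funext => N; rewrite /cis_partial (big_morph _ ImD erefl).
  rewrite /series /= big_mkord -sumrN.
  by apply: eq_bigr => k _; rewrite exp_coeffNi.
split; first by rewrite /= unlock; exact: is_cvg_series_cos_coeff.
by apply: cvgN; rewrite unlock; exact: is_cvg_series_sin_coeff.
Qed.

Lemma cvg_sumr (I : finType) (F : I -> nat -> R) (l : I -> R) :
  (forall i, (F i @ \oo --> l i)%classic) ->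
  ((fun N => \sum_i F i N) @ \oo --> \sum_i l i)%classic.
Proof.
move=> Fl; elim: (index_enum I) => [|i s IH].
  by under eq_fun do rewrite big_nil; rewrite big_nil; exact: cvg_cst.
by under eq_fun do rewrite big_cons; rewrite big_cons; exact: cvgD.
Qed.

Lemma conj_diagE m (V : 'M[C]_m) (d : 'I_m -> C) i j :
  (V *m diag_mx (\row_k d k) *m adjmx V) i j =
  \sum_l (V i l * conjc (V j l)) * d l.
Proof.
rewrite mxE; apply: eq_bigr => l _.
by rewrite mul_mx_diag adjmxE !mxE mulrAC.
Qed.

Lemma conj_diagX m (V : 'M[C]_m) (d : 'I_m -> C) n : unitary V ->
  (V *m diag_mx (\row_k d k) *m adjmx V) ^+ n =
  V *m diag_mx (\row_k (d k ^+ n)) *m adjmx V.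
Proof.
move=> uV; elim: n => [|n IH].
  have -> : diag_mx (\row_k (d k ^+ 0)) = 1%:M :> 'M[C]_m.
    by rewrite -diag_const_mx; congr diag_mx; apply/rowP => k; rewrite !mxE.
  by rewrite mulmx1 uV.
rewrite exprSr IH -mulmxE -!mulmxA (mulmxA (adjmx V) V) (unitary_adj uV) mul1mx.
rewrite (mulmxA (diag_mx _) (diag_mx _)) mulmx_diag.
by congr (_ *m (diag_mx _ *m _)); apply/rowP => k; rewrite !mxE exprSr.
Qed.

Lemma is_expmx_spectral m (V : 'M[C]_m) (t : 'I_m -> R) : unitary V ->
  is_expmx (Complex 0 (-1) *: (V *m diag_mx (\row_k (t k)%:C%C) *m adjmx V))
    (V *m diag_mx (\row_k cis (t k)) *m adjmx V).
Proof.
move=> uV i j.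
have pE N : expmx_partial (Complex 0 (-1) *: (V *m diag_mx (\row_k (t k)%:C%C) *m adjmx V)) N i j
    = \sum_l (V i l * conjc (V j l)) * cis_partial (t l) N.
  rewrite /expmx_partial summxE.
  have -> : Complex 0 (-1) *: (V *m diag_mx (\row_k (t k)%:C%C) *m adjmx V) =
      V *m diag_mx (\row_k (Complex 0 (-1) * (t k)%:C%C)) *m adjmx V.
    rewrite scalemxAl scalemxAr; congr (_ *m _ *m _).
    by rewrite -linearZ; congr diag_mx; apply/rowP => k; rewrite !mxE.
  under eq_bigr do rewrite mxE conj_diagX // conj_diagE mulr_sumr.
  rewrite exchange_big /=; apply: eq_bigr => l _.
  by rewrite mulr_sumr; apply: eq_bigr => k _; rewrite mulrCA.
have ReM (x y : C) : complex.Re (x * y) =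
    complex.Re x * complex.Re y - complex.Im x * complex.Im y.
  by case: x; case: y.
have ImM (x y : C) : complex.Im (x * y) =
    complex.Re x * complex.Im y + complex.Im x * complex.Re y.
  by case: x; case: y.
have ImD : {morph (@complex.Im R) : x y / x + y} by case=> ? ? [].
rewrite conj_diagE Re_sum (big_morph _ ImD erefl).
split.
- under eq_fun do rewrite pE Re_sum.
  apply: cvg_sumr => l; under eq_fun do rewrite ReM; rewrite ReM.
  have [c1 c2] := cvg_cis_partial (t l).
  by apply: cvgB; apply: cvgM => //; exact: cvg_cst.
- under eq_fun do rewrite pE (big_morph _ ImD erefl).
  apply: cvg_sumr => l; under eq_fun do rewrite ImM; rewrite ImM.
  have [c1 c2] := cvg_cis_partial (t l).
  by apply: cvgD; apply: cvgM => //; exact: cvg_cst.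
Qed.

Lemma is_expmx_unique m (A X Y : 'M[C]_m) : is_expmx A X -> is_expmx A Y -> X = Y.
Proof.
move=> hX hY; apply/matrixP => i j.
have [rX iX] := hX i j; have [rY iY] := hY i j.
apply/eqP; rewrite eq_complex; apply/andP; split; apply/eqP.
  exact: (cvg_unique _ rX rY).
exact: (cvg_unique _ iX iY).
Qed.

Lemma vnormE m (v : 'cV[C]_m) : vnorm v = Num.sqrt (\sum_i sqn (v i 0)).
Proof. by []. Qed.

Lemma sum_sqnE m (v : 'cV[C]_m) : (\sum_i sqn (v i 0))%:C%C = (adjmx v *m v) 0 0.
Proof. by rewrite mulmx_diag_adj. Qed.

Lemma sum_sqn_unitary m (V : 'M[C]_m) (v : 'cV[C]_m) : unitary V ->
  \sum_i sqn ((adjmx V *m v) i 0) = \sum_i sqn (v i 0).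
Proof.
move=> uV; apply: complexI; rewrite !sum_sqnE adjmxM adjmxK.
by rewrite -mulmxA (mulmxA V) uV mul1mx.
Qed.

(** [sup] can be compared with elements of the set only once a bound is known; the one used is the
    Frobenius norm of H. *)
Lemma opnorm_has_ubound m (V : 'M[C]_m) (t : 'I_m -> R) : unitary V ->
  let H := V *m diag_mx (\row_k (t k)%:C%C) *m adjmx V in
  has_ubound ((fun v : 'cV[C]_m => vnorm (H *m v)) @` [set v | vnorm v = 1])%classic.
Proof.
move=> uV H; exists (Num.sqrt (\sum_k t k ^+ 2)) => _ [v /= v1 <-].
have sv : \sum_i sqn (v i 0) = 1.
  by rewrite -[LHS]sqr_sqrtr ?sumr_ge0 // => [|i _]; rewrite ?sqn_ge0 // -vnormE v1 expr1n.
rewrite vnormE ler_sqrt; last by rewrite sumr_ge0 // => k _; exact: sqr_ge0.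
rewrite -(sum_sqn_unitary _ uV) /H !mulmxA (unitary_adj uV) mul1mx -mulmxA.
rewrite -(sum_sqn_unitary _ uV) in sv.
move: (adjmx V *m v) sv => y sv.
apply: ler_sum => i _; rewrite mul_diag_mx !mxE sqnM sqn_real ler_piMr ?sqr_ge0 //.
rewrite -sv (bigD1 i) //= lerDl sumr_ge0 // => k _; exact: sqn_ge0.
Qed.

Lemma opnorm_ge m (V : 'M[C]_m) (t : 'I_m -> R) j : unitary V ->
  `|t j| <= opnorm (V *m diag_mx (\row_k (t k)%:C%C) *m adjmx V).
Proof.
move=> uV; apply: (ub_le_sup (opnorm_has_ubound t uV)).
have eV : adjmx V *m col j V = delta_mx j 0.
  by rewrite colE mulmxA (unitary_adj uV) mul1mx.
exists (col j V) => /=.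
  rewrite vnormE -(sum_sqn_unitary _ uV) eV (bigD1 j) //= big1 ?addr0.
    by rewrite mxE !eqxx -[X in sqn X]/(1%:C%C) sqn_real expr1n sqrtr1.
  move=> i ij; rewrite mxE (negPf ij) /= -[X in sqn X]/(0%:C%C) sqn_real.
  by rewrite expr0n.
rewrite vnormE -(sum_sqn_unitary _ uV) !mulmxA (unitary_adj uV) mul1mx -mulmxA eV.
rewrite (bigD1 j) //= big1 ?addr0.
  by rewrite mul_diag_mx !mxE !eqxx mulr1 sqn_real sqrtr_sqr.
move=> i ij; rewrite mul_diag_mx !mxE (negPf ij) mulr0.
by rewrite -[X in sqn X]/(0%:C%C) sqn_real expr0n.
Qed.

(** The set whose infimum is [egate U] must be nonempty for a lower bound to pass to [inf]. Choosing
    an angle for every eigenvalue of U gives H, with phase 0. *)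
Lemma generator_exists m (U : 'M[C]_m) : unitary U ->
  exists H : 'M[C]_m, adjmx H = H /\
    exists chi : R, is_expmx (Complex 0 (-1) *: H) (Complex (cos chi) (- sin chi) *: U).
Proof.
move=> uU; have [|V [d [uV UE]]] := @normal_spectral _ _ U; first by rewrite uU unitary_adj.
have sd k : sqn (d 0 k) = 1.
  have DE : diag_mx d = adjmx V *m U *m V.
    by rewrite UE !mulmxA (unitary_adj uV) mul1mx -mulmxA (unitary_adj uV) mulmx1.
  have /matrixP/(_ k k) : diag_mx d *m adjmx (diag_mx d) = 1%:M.
    rewrite DE !adjmxM adjmxK -!mulmxA (mulmxA V) uV mul1mx (mulmxA U) uU mul1mx.
    exact: unitary_adj.
  rewrite adjmx_diag mulmx_diag !mxE eqxx !mulr1n sqnE.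
  by move=> /(congr1 (@complex.Re R)).
have [t tE] := fin_all_exists (fun k => cis_surj (sd k)).
exists (V *m diag_mx (\row_k (t k)%:C%C) *m adjmx V); split.
  rewrite !adjmxM adjmxK adjmx_diag mulmxA; congr (_ *m diag_mx _ *m _).
  by apply/rowP => k; rewrite !mxE conjc_real.
exists 0; rewrite cos0 sin0 oppr0.
have -> : Complex 1 0 = 1 :> C by [].
rewrite scale1r UE.
have -> : d = \row_k cis (t k) by apply/rowP => k; rewrite mxE -tE.
exact: is_expmx_spectral.
Qed.

(* The numerical range of exp(-iH) is the convex hull of the points cis(t_k). *)
Lemma numerical_range_lower m (U H : 'M[C]_m) (chi : R) (psi : 'cV[C]_m) :
  adjmx H = H ->
  is_expmx (Complex 0 (-1) *: H) (Complex (cos chi) (- sin chi) *: U) ->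
  adjmx psi *m psi = 1%:M -> opnorm H < pi / 2 ->
  0 <= opnorm H /\
  1 - sqn ((adjmx psi *m U *m psi) 0 0) <= sin (opnorm H) ^+ 2.
Proof.
move=> hH hE psi1 small; have [V [t [uV HE]]] := hermitian_spectral hH.
have UE : cis chi *: U = V *m diag_mx (\row_k cis (t k)) *m adjmx V.
  by apply: (is_expmx_unique hE); rewrite HE; exact: is_expmx_spectral.
have [y yE] : exists y, y = adjmx V *m psi by exists (adjmx V *m psi).
pose q k := sqn (y k 0).
have q1 : \sum_k q k = 1.
  by rewrite /q yE sum_sqn_unitary //; apply: complexI; rewrite sum_sqnE psi1 !mxE.
(* The free phase chi disappears in the modulus. *)
have -> : sqn ((adjmx psi *m U *m psi) 0 0) = sqn (\sum_k (q k)%:C%C * cis (t k)).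
  rewrite -[LHS]mul1r -(sqn_cis chi) -sqnM.
  have -> : cis chi * (adjmx psi *m U *m psi) 0 0 = (adjmx psi *m (cis chi *: U) *m psi) 0 0.
    by rewrite -scalemxAr -scalemxAl [RHS]mxE.
  rewrite UE.
  have -> : adjmx psi *m (V *m diag_mx (\row_k cis (t k)) *m adjmx V) *m psi
      = adjmx y *m (diag_mx (\row_k cis (t k)) *m y).
    by rewrite yE adjmxM adjmxK !mulmxA.
  rewrite mxE; congr sqn; apply: eq_bigr => k _.
  rewrite mul_diag_mx adjmxE !mxE /q -sqnE; ring.
have tle k : `|t k| <= opnorm H by rewrite HE; exact: opnorm_ge.
have [k0 _|no] := pickP (@predT 'I_m); last first.
  by move: q1; rewrite big1 => [/eqP|k _]; [rewrite eq_sym oner_eq0 | have := no k].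
have th0 : 0 <= opnorm H by exact: le_trans (normr_ge0 _) (tle k0).
split=> //; have c0 : 0 <= cos (opnorm H).
  by apply: cos_ge0_pihalf; rewrite (ltW small) (le_trans _ th0) // oppr_le0 divr_ge0 // pi_ge0.
have ct k : cos (opnorm H) <= cos (t k).
  have tin : `|t k| \in `[0, pi].
    by rewrite in_itv /= normr_ge0; have := tle k; have := pi_ge0 R; lra.
  have oin : opnorm H \in `[0, pi] by rewrite in_itv /= th0; have := pi_ge0 R; lra.
  by rewrite -(cos_norm (t k)) leNgt (ltr_cos oin tin) ltNge tle.
set z := \sum_k _.
(* Every point [cis (t k)] lies in the half-plane Re >= cos(opnorm H), hence so does their average;
   as this cosine is nonnegative, it also bounds the modulus of z. *)
have zc : cos (opnorm H) <= complex.Re z.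
  rewrite /z Re_sum -[leLHS]mul1r -q1 mulr_suml; apply: ler_sum => k _ /=.
  by rewrite mul0r subr0 ler_wpM2l // sqn_ge0.
have : cos (opnorm H) ^+ 2 <= sqn z.
  by rewrite /sqn -[leLHS]addr0 lerD ?sqr_ge0 // lerXn2r // nnegrE // (le_trans c0).
have := cos2Dsin2 (opnorm H); lra.
Qed.

(** The estimate is inverted to asin x <= opnorm H, uniform over admissible H, so that it passes to
    the infimum. The cap at pi/2 costs nothing, as asin x <= pi/2, and keeps the angle where sin
    increases. *)
Lemma egate_numerical_range m (U : 'M[C]_m) (psi : 'cV[C]_m) :
  unitary U -> adjmx psi *m psi = 1%:M ->
  Num.sqrt (1 - sqn ((adjmx psi *m U *m psi) 0 0))
    <= sin (Num.min (egate U) (pi / 2)).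
Proof.
move=> uU psi1; set s := 1 - sqn _.
have s1 : s <= 1 by rewrite /s gerBl sqn_ge0.
pose x := Num.sqrt s; rewrite -/x.
have x0 : 0 <= x by exact: sqrtr_ge0.
have x1 : x <= 1 by rewrite -(@sqrtr1 R) ler_wsqrtr.
have x01 : -1 <= x <= 1 by apply/andP; split; lra.
have pi0 := pi_ge0 R.
have ax2 := asin_lepi2 x01; have axN := asin_geNpi2 x01.
have sax : sin (asin x) = x by apply: asinK; rewrite in_itv.
have ae : asin x <= egate U.
  apply: lb_le_inf.
    have [H [hH hE]] := generator_exists uU.
    by exists (opnorm H), H.
  move=> _ [H [hH [chi hE]] <-].
  rewrite leNgt; apply/negP => lt.
  have small : opnorm H < pi / 2 by exact: lt_le_trans ax2.
  have [h0 hs] := numerical_range_lower hH hE psi1 small.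
  have sh : sin (opnorm H) < x.
    by rewrite -sax ltr_sin // in_itv /=; apply/andP; split; lra.
  have sh0 : 0 <= sin (opnorm H) by apply: sin_ge0_pi; apply/andP; split; lra.
  by have := ler_wsqrtr hs; rewrite sqrtr_sqr ger0_norm // -/s -/x leNgt sh.
have ax0 : 0 <= asin x.
  rewrite leNgt; apply/negP => a0; have : sin (asin x) < sin 0.
    by rewrite ltr_sin // in_itv /=; apply/andP; split; lra.
  by rewrite sax sin0 ltNge sqrtr_ge0.
have amin : asin x <= Num.min (egate U) (pi / 2) by rewrite le_min ae.
have minp : Num.min (egate U) (pi / 2) <= pi / 2 by rewrite ge_min lexx orbT.
have min_in : Num.min (egate U) (pi / 2) \in `[- (pi / 2), pi / 2].
  by rewrite in_itv /=; apply/andP; split; lra.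
have ain : asin x \in `[- (pi / 2), pi / 2] by rewrite in_itv /= axN ax2.
by rewrite -{1}sax leNgt (ltr_sin min_in ain) ltNge amin.
Qed.

End GateEnergy.

(** * Qubit indices and cuts of the chain *)

Section QubitIndices.

Lemma ltn_digits (a t e d : nat) : (a < e)%N -> (t < d)%N -> (a * d + t < e * d)%N.
Proof.
move=> ae td; apply: (@leq_trans (a.+1 * d)); last by rewrite leq_mul2r ae orbT.
by rewrite mulSn addnC ltn_add2r.
Qed.

Lemma eqn_mod_mul (d e x y : nat) : (0 < d)%N -> (0 < e)%N ->
  (x %% (e * d) == y %% (e * d))%N =
  ((x %/ d) %% e == (y %/ d) %% e)%N && (x %% d == y %% d)%N.
Proof.
move=> d0 e0; have E z : (z %% (e * d) = (z %/ d) %% e * d + z %% d)%N.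
  rewrite {1}(divn_eq z d) {1}(divn_eq (z %/ d) e) mulnDl -mulnA -addnA modnMDl.
  by rewrite modn_small // ltn_digits // ltn_pmod.
rewrite !E; apply/eqP/andP => [H|[/eqP -> /eqP ->]] //.
have := congr1 (fun z => z %/ d)%N H; rewrite !divnMDl // !(divn_small (ltn_pmod _ d0)) !addn0 => ->.
by have := congr1 (fun z => z %% d)%N H; rewrite !modnMDl !modn_mod => ->.
Qed.

(** The modulus copies [pidx], so that [redA] and [redB] become instances of [ptr]; it is the
    identity when N = p + q. *)
Definition mix (p q N : nat) (a : 'I_(2 ^ p) * 'I_(2 ^ q)) : 'I_(2 ^ N) :=
  Ordinal (ltn_pmod (a.1 * 2 ^ q + a.2) (expn_gt0 2 N)).

Definition unmix (p q N : nat) (x : 'I_(2 ^ N)) : 'I_(2 ^ p) * 'I_(2 ^ q) :=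
  (Ordinal (ltn_pmod (x %/ 2 ^ q) (expn_gt0 2 p)),
   Ordinal (ltn_pmod x (expn_gt0 2 q))).

Variables p q N : nat.
Hypothesis NE : N = (p + q)%N.

Lemma mix_val (a : 'I_(2 ^ p) * 'I_(2 ^ q)) : mix N a = (a.1 * 2 ^ q + a.2)%N :> nat.
Proof.
by rewrite /= modn_small // NE expnD ltn_digits.
Qed.

Lemma mix_pair_val (a : 'I_(2 ^ p)) (b : 'I_(2 ^ q)) : mix N (a, b) = (a * 2 ^ q + b)%N :> nat.
Proof. exact: mix_val. Qed.

Lemma unmix_val1 (x : 'I_(2 ^ N)) : (unmix p q x).1 = (x %/ 2 ^ q)%N :> nat.
Proof.
rewrite /= modn_small // ltn_divLR ?expn_gt0 // -expnD -NE; exact: ltn_ord.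
Qed.

Lemma unmix_val2 (x : 'I_(2 ^ N)) : (unmix p q x).2 = (x %% 2 ^ q)%N :> nat.
Proof. by []. Qed.

Lemma mixK : cancel (@mix p q N) (@unmix p q N).
Proof.
case=> a b; congr (_, _); apply: val_inj.
  rewrite [LHS]unmix_val1 mix_val /= divnMDl ?expn_gt0 //.
  by rewrite divn_small ?addn0.
by rewrite [LHS]unmix_val2 mix_val /= modnMDl modn_small.
Qed.

Lemma unmixK : cancel (@unmix p q N) (@mix p q N).
Proof.
by move=> x; apply: val_inj; rewrite [LHS]mix_val unmix_val1 /= -divn_eq.
Qed.

Definition mixr (a : 'I_(2 ^ q) * 'I_(2 ^ p)) := mix N (a.2, a.1).
Definition unmixr (x : 'I_(2 ^ N)) := ((unmix p q x).2, (unmix p q x).1).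

Lemma mixrK : cancel mixr unmixr.
Proof. by case=> a b; rewrite /unmixr /mixr mixK. Qed.

Lemma unmixrK : cancel unmixr mixr.
Proof. by move=> x; rewrite -[RHS]unmixK. Qed.

End QubitIndices.

(** * Reduced states of the chain and the action of the gate on them *)

Section Chain.
Variable R : realType.
Local Notation C := R[i].

(** Block lengths are variables tied by equations, which avoids casts between ordinal types such as
    those for n - k and 1 + (n - k.+1). *)
Lemma mixA p q r pq qr N (a : 'I_(2 ^ p)) (t : 'I_(2 ^ q)) (b : 'I_(2 ^ r)) :
  pq = (p + q)%N -> qr = (q + r)%N -> N = (p + q + r)%N ->
  mix N (mix pq (a, t), b) = mix N (a, mix qr (t, b)).
Proof.
move=> pqE qrE NE; apply: val_inj.
have h1 : N = (pq + r)%N by rewrite pqE.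
have h2 : N = (p + qr)%N by rewrite qrE addnA.
rewrite [LHS](mix_pair_val h1) [RHS](mix_pair_val h2).
rewrite (mix_pair_val pqE) (mix_pair_val qrE) qrE.
by rewrite expnD mulnDl mulnA addnA.
Qed.

Lemma ptr_ptr p q r pq qr N (X : 'M[C]_(2 ^ N)) :
  pq = (p + q)%N -> qr = (q + r)%N -> N = (p + q + r)%N ->
  ptr (@mix p q pq) (ptr (@mix pq r N) X) = ptr (@mix p qr N) X.
Proof.
move=> pqE qrE NE; apply/matrixP => i j; rewrite !mxE.
rewrite [RHS](sum_factor (mixK qrE) (unmixK qrE)); apply: eq_bigr => t _.
by rewrite mxE; apply: eq_bigr => b _; rewrite !(mixA _ _ _ pqE qrE NE).
Qed.

Lemma ptrr_ptrr p q r pq qr N (X : 'M[C]_(2 ^ N)) :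
  pq = (p + q)%N -> qr = (q + r)%N -> N = (p + q + r)%N ->
  ptr (@mixr q r qr) (ptr (@mixr p qr N) X) = ptr (@mixr pq r N) X.
Proof.
move=> pqE qrE NE; apply/matrixP => i j; rewrite !mxE.
rewrite [RHS](sum_factor (mixK pqE) (unmixK pqE)) exchange_big; apply: eq_bigr => t _.
rewrite mxE; apply: eq_bigr => b _.
by rewrite /mixr /= !(mixA _ _ _ pqE qrE NE).
Qed.

Lemma redAE n j (rho : 'M[C]_(2 ^ n)) : redA j rho = ptr (@mix j (n - j) n) rho.
Proof.
apply/matrixP => a b; rewrite !mxE; apply: eq_bigr => t _.
by congr (rho _ _); apply: val_inj.
Qed.

Lemma redBE n j (rho : 'M[C]_(2 ^ n)) : redB j rho = ptr (@mixr j (n - j) n) rho.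
Proof.
apply/matrixP => a b; rewrite !mxE; apply: eq_bigr => t _.
by congr (rho _ _); apply: val_inj.
Qed.

Lemma embed2_left n j k (u : 'M[C]_4) : (k + 2 <= j)%N -> (j <= n)%N ->
  embed2 n k u = lift_mx (@unmix j (n - j) n) (embed2 j k u).
Proof.
move=> kj jn; have NE : n = (j + (n - j))%N by rewrite subnKC.
have nk : (n - k = (j - k) + (n - j))%N by lia.
have nk2 : (n - k - 2 = (j - k - 2) + (n - j))%N by lia.
have v1 := unmix_val1 NE.
have mE (z : 'I_(2 ^ n)) : midx k z = midx k (unmix j (n - j) z).1.
  apply: val_inj; change ((z %/ 2 ^ (n - k - 2)) %% 4 =
    ((unmix j (n - j) z).1 %/ 2 ^ (j - k - 2)) %% 4)%N.
  by rewrite v1 nk2 expnD mulnC divnMA.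
apply/matrixP => x y; rewrite [LHS]mxE [RHS]mxE [embed2 j k u _ _]mxE (mE x) (mE y).
have c1 : (x %/ 2 ^ (n - k) == y %/ 2 ^ (n - k))%N =
    ((unmix j (n - j) x).1 %/ 2 ^ (j - k) == (unmix j (n - j) y).1 %/ 2 ^ (j - k))%N.
  by rewrite !v1 nk expnD mulnC !divnMA.
(* The digits after the gate are the last j - k - 2 of the left block followed by the whole right
   block. *)
have c2 : (x %% 2 ^ (n - k - 2) == y %% 2 ^ (n - k - 2))%N =
    ((unmix j (n - j) x).1 %% 2 ^ (j - k - 2) == (unmix j (n - j) y).1 %% 2 ^ (j - k - 2))%N
    && ((unmix j (n - j) x).2 == (unmix j (n - j) y).2).
  by rewrite !v1 nk2 expnD (eqn_mod_mul _ _ (expn_gt0 2 _) (expn_gt0 2 _)).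
rewrite c1 c2; move: (_ == _)%N => b1; move: (_ == _)%N => b2; move: (_ == _) => b3.
by case: b1; case: b2; case: b3; rewrite /= ?mulr1n ?mulr0n.
Qed.

Lemma embed2_right n j k (u : 'M[C]_4) : (j <= k)%N -> (k + 2 <= n)%N ->
  embed2 n k u = lift_mx (@unmixr j (n - j) n) (embed2 (n - j) (k - j) u).
Proof.
move=> jk kn; have NE : n = (j + (n - j))%N by lia.
apply/matrixP => x y; rewrite !mxE.
have nk : (n - j - (k - j) = n - k)%N by lia.
have nj : (2 ^ (n - j) = 2 ^ (k - j) * 2 ^ (n - k))%N by rewrite -expnD; congr (2 ^ _)%N; lia.
have nj2 : (2 ^ (n - j) = 2 ^ (k - j) * 4 * 2 ^ (n - k - 2))%N.
  by rewrite -[4%N]/(2 ^ 2)%N -!expnD; congr (2 ^ _)%N; lia.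
have mE (z : 'I_(2 ^ n)) : midx k z = midx (k - j) (unmixr j (n - j) z).1.
  apply: val_inj; rewrite /= nk nj2 -modn_divl modn_dvdm //.
  exact: dvdn_mull.
rewrite -!mE nk.
have c1 : ((unmixr j (n - j) x).2 == (unmixr j (n - j) y).2) =
    (x %/ 2 ^ (n - j) == y %/ 2 ^ (n - j))%N.
  have v2 (z : 'I_(2 ^ n)) : nat_of_ord (unmixr j (n - j) z).2 = (z %/ 2 ^ (n - j))%N.
    exact: (unmix_val1 NE z).
  by rewrite -!v2.
(* The k digits before the gate are those of the first j qubits followed by the next k - j. *)
have c2 : (x %/ 2 ^ (n - k) == y %/ 2 ^ (n - k))%N =
    (x %/ 2 ^ (n - j) == y %/ 2 ^ (n - j))%N &&
    ((unmixr j (n - j) x).1 %/ 2 ^ (n - k) == (unmixr j (n - j) y).1 %/ 2 ^ (n - k))%N.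
  rewrite /= nj -!modn_divl mulnC !divnMA.
  move: (x %/ _)%N (y %/ _)%N => a b.
  apply/eqP/andP => [->|[/eqP h1 /eqP h2]] //.
  by rewrite (divn_eq a (2 ^ (k - j))) h1 h2 -divn_eq.
have c3 (z : 'I_(2 ^ n)) : ((unmixr j (n - j) z).1 %% 2 ^ (n - k - 2) = z %% 2 ^ (n - k - 2))%N.
  by rewrite /= nj2 modn_dvdm // dvdn_mull.
rewrite c1 c2 !c3.
by case: (x %/ 2 ^ (n - j) == y %/ 2 ^ (n - j))%N.
Qed.

(** The k qubits before the gate and then those after it are split off as identity factors, leaving
    [u] on two qubits. *)
Lemma unitary_embed2 n k (u : 'M[C]_4) : (k + 2 <= n)%N -> unitary u ->
  unitary (@embed2 R n k u).
Proof.
move=> kn uu.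
have kn' : n = (k + (n - k))%N by lia.
rewrite (@embed2_right n k k) //.
apply: (unitary_lift (mixrK kn') (unmixrK kn')); rewrite subnn.
have nk : (n - k = 2 + (n - k - 2))%N by lia.
rewrite (@embed2_left (n - k) 2 0) //; last by lia.
apply: (unitary_lift (mixK nk) (unmixK nk)).
suff -> : embed2 2 0 u = u by [].
apply/matrixP => x y; rewrite mxE !divn_small ?ltn_ord //= !modn1 eqxx.
by congr (u _ _); apply: val_inj; rewrite /= divn1 modn_small.
Qed.

Lemma vN_entropy_conj m (V A : 'M[C]_m) : unitary V -> psd A ->
  vN_entropy (V *m A *m adjmx V) = vN_entropy A.
Proof.
move=> uV pA; have [Z [w [uZ w0 AE]]] := psd_spectral pA.
have uVZ : unitary (V *m Z).
  by rewrite /unitary adjmxM -mulmxA (mulmxA Z) uZ mul1mx uV.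
rewrite (vN_entropy_diag uZ AE); apply: (vN_entropy_diag uVZ).
by rewrite AE adjmxM !mulmxA.
Qed.

Section Gate.
Variables (n k : nat) (rho : 'M[C]_(2 ^ n)) (u : 'M[C]_4).
Hypotheses (prho : psd rho) (uu : unitary u) (kn : (k + 2 <= n)%N).
Let U : 'M[C]_(2 ^ n) := embed2 n k u.
Let sigma := U *m rho *m adjmx U.

Lemma redA_gate_right j : (j <= k)%N -> redA j sigma = redA j rho.
Proof.
move=> jk; have jE : n = (j + (n - j))%N by lia.
have uR : unitary (embed2 (n - j) (k - j) u) by apply: unitary_embed2 => //; lia.
rewrite !redAE /sigma /U (embed2_right u jk kn).
exact: (ptr_lift_other (mixrK jE) (unmixrK jE) rho uR).
Qed.

Lemma redB_gate_right j : (j <= k)%N ->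
  let V := embed2 (n - j) (k - j) u in redB j sigma = V *m redB j rho *m adjmx V.
Proof.
move=> jk V; have jE : n = (j + (n - j))%N by lia.
rewrite !redBE /sigma /U (embed2_right u jk kn).
exact: (ptr_lift (mixrK jE) (unmixrK jE)).
Qed.

Lemma redB_gate_left j : (k + 2 <= j)%N -> (j <= n)%N -> redB j sigma = redB j rho.
Proof.
move=> kj jn; have jE : n = (j + (n - j))%N by lia.
have uL : unitary (embed2 j k u) by exact: unitary_embed2.
rewrite !redBE /sigma /U (embed2_left u kj jn).
exact: (ptr_lift_other (mixK jE) (unmixK jE) rho uL).
Qed.

Lemma redA_gate_left j : (k + 2 <= j)%N -> (j <= n)%N ->
  let V := embed2 j k u in redA j sigma = V *m redA j rho *m adjmx V.
Proof.
move=> kj jn V; have jE : n = (j + (n - j))%N by lia.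
rewrite !redAE /sigma /U (embed2_left u kj jn).
exact: (ptr_lift (mixK jE) (unmixK jE)).
Qed.

Lemma psd_redA j (X : 'M[C]_(2 ^ n)) : psd X -> psd (redA j X).
Proof. by move=> pX; rewrite redAE; exact: psd_ptr. Qed.

Lemma psd_redB j (X : 'M[C]_(2 ^ n)) : psd X -> psd (redB j X).
Proof. by move=> pX; rewrite redBE; exact: psd_ptr. Qed.

Lemma vN_entropy_gate : vN_entropy sigma = vN_entropy rho.
Proof. by apply: vN_entropy_conj => //; exact: unitary_embed2. Qed.

Lemma mutinfo_gate j : (j < n)%N -> j != k.+1 -> mutinfo j sigma = mutinfo j rho.
Proof.
move=> jn jk.
have EA : vN_entropy (redA j sigma) = vN_entropy (redA j rho).
  have [le|lt] := leqP j k; first exact: (congr1 _ (redA_gate_right le)).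
  have kj : (k + 2 <= j)%N by lia.
  rewrite (redA_gate_left kj (ltnW jn)).
  exact: (vN_entropy_conj (unitary_embed2 kj uu) (psd_redA j prho)).
have EB : vN_entropy (redB j sigma) = vN_entropy (redB j rho).
  have [le|lt] := leqP j k.
    have kj : (k - j + 2 <= n - j)%N by lia.
    rewrite (redB_gate_right le).
    exact: (vN_entropy_conj (unitary_embed2 kj uu) (psd_redB j prho)).
  have kj : (k + 2 <= j)%N by lia.
  exact: (congr1 _ (redB_gate_left kj (ltnW jn))).
rewrite /mutinfo EA EB.
exact: (congr1 (fun z => vN_entropy (redA j rho) + vN_entropy (redB j rho) - z) vN_entropy_gate).
Qed.

Lemma Echain_gate : Echain sigma - Echain rho =
  (n - 1)%N%:R^-1 * (mutinfo k.+1 sigma - mutinfo k.+1 rho).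
Proof.
rewrite /Echain -mulrBr -sumrB; congr (_ * _).
(* The gate acts on S_{k+1} and S_{k+2}, so only the cut j = k+1 separates its two qubits. *)
have kin : k.+1 \in index_iota 1 n by rewrite mem_index_iota; lia.
rewrite (bigD1_seq k.+1 kin (iota_uniq _ _)) /= big_seq_cond.
rewrite [X in _ + X]big1 ?addr0 // => j /andP[]; rewrite mem_index_iota => /andP[_ jn] jk.
by rewrite mutinfo_gate // subrr.
Qed.

End Gate.

End Chain.

(** * Bounds on the mutual information *)

Section CutBounds.
Variable R : realType.
Local Notation C := R[i].

(** Exchanging rho with sigma and P with Q preserves the hypotheses, whence the absolute values. *)
Lemma vN_entropy_gap (M N : nat) (T : finType) (f : 'I_M * T -> 'I_N)
    (g : 'I_N -> 'I_M * T) (rho sigma P Q : 'M[C]_N) (nu : R) :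
  cancel f g -> cancel g f -> #|T| = 2 ->
  psd rho -> psd sigma -> psd P -> psd Q -> sigma + Q = rho + P ->
  complex.Re (\tr rho) = 1 -> complex.Re (\tr sigma) = 1 ->
  complex.Re (\tr P) = nu -> complex.Re (\tr Q) = nu ->
  ptr f rho = ptr f sigma ->
  `|vN_entropy sigma - vN_entropy rho| <= 2 * ln 2 /\
  `|vN_entropy sigma - vN_entropy rho| <=
    2 * nu * ln 2 + (1 + nu) * hbin (nu / (1 + nu)).
Proof.
move=> fK gK T2 pr ps pP pQ E tr ts tP tQ mE.
have T0 : (0 < #|T|)%N by rewrite T2.
have := vN_entropy_marginal fK gK T0 pr ps tr ts mE.
have := vN_entropy_marginal fK gK T0 ps pr ts tr (esym mE).
have := vN_entropy_continuity fK gK T0 pr ps pP pQ E ts tP tQ mE.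
have := vN_entropy_continuity fK gK T0 ps pr pQ pP (esym E) tr tQ tP (esym mE).
rewrite T2; move: (vN_entropy sigma) (vN_entropy rho) => s r h1 h2 h3 h4.
by rewrite !ler_norml; split; apply/andP; split; lra.
Qed.

Lemma redAD n j (X Y : 'M[C]_(2 ^ n)) : redA j (X + Y) = redA j X + redA j Y.
Proof. by rewrite !redAE ptrD. Qed.

Lemma redBD n j (X Y : 'M[C]_(2 ^ n)) : redB j (X + Y) = redB j X + redB j Y.
Proof. by rewrite !redBE ptrD. Qed.

Lemma tr_redA n j (X : 'M[C]_(2 ^ n)) : (j <= n)%N -> \tr (redA j X) = \tr X.
Proof.
move=> jn; have jE : n = (j + (n - j))%N by lia.
by rewrite redAE (tr_ptr (mixK jE) (unmixK jE)).
Qed.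

Lemma tr_redB n j (X : 'M[C]_(2 ^ n)) : (j <= n)%N -> \tr (redB j X) = \tr X.
Proof.
move=> jn; have jE : n = (j + (n - j))%N by lia.
by rewrite redBE (tr_ptr (mixrK jE) (unmixrK jE)).
Qed.

Lemma mutinfo_gap n k (rho sigma P Q : 'M[C]_(2 ^ n)) (nu : R) :
  (k + 2 <= n)%N -> psd rho -> psd sigma -> psd P -> psd Q ->
  sigma + Q = rho + P ->
  complex.Re (\tr rho) = 1 -> complex.Re (\tr sigma) = 1 ->
  complex.Re (\tr P) = nu -> complex.Re (\tr Q) = nu ->
  redA k sigma = redA k rho -> redB k.+2 sigma = redB k.+2 rho ->
  vN_entropy sigma = vN_entropy rho ->
  `|mutinfo k.+1 sigma - mutinfo k.+1 rho| <= 4 * ln 2 /\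
  `|mutinfo k.+1 sigma - mutinfo k.+1 rho| <=
    4 * nu * ln 2 + 2 * (1 + nu) * hbin (nu / (1 + nu)).
Proof.
move=> kn pr ps pP pQ E tr ts tP tQ mA mB SE.
have card2 : #|'I_(2 ^ 1)| = 2 by rewrite card_ord.
have k1n : (k.+1 <= n)%N by lia.
have k1 : k.+1 = (k + 1)%N by lia.
have nk : (n - k = 1 + (n - k.+1))%N by lia.
have nE : n = (k + 1 + (n - k.+1))%N by lia.
have EA : redA k.+1 sigma + redA k.+1 Q = redA k.+1 rho + redA k.+1 P.
  by rewrite -!redAD E.
(* Tracing S_{k+1} out of the left side leaves S_1...S_k; below, tracing S_{k+2} out of the right
   side leaves S_{k+3}...S_n. *)
have mA' : ptr (@mix k 1 k.+1) (redA k.+1 rho) = ptr (@mix k 1 k.+1) (redA k.+1 sigma).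
  by rewrite !redAE !(ptr_ptr _ k1 nk nE) -!redAE mA.
have [a1 a2] := vN_entropy_gap (mixK k1) (unmixK k1) card2 (psd_redA k.+1 pr)
  (psd_redA k.+1 ps) (psd_redA k.+1 pP) (psd_redA k.+1 pQ) EA
  (etrans (congr1 _ (tr_redA _ k1n)) tr) (etrans (congr1 _ (tr_redA _ k1n)) ts)
  (etrans (congr1 _ (tr_redA _ k1n)) tP) (etrans (congr1 _ (tr_redA _ k1n)) tQ) mA'.
have k2 : k.+2 = (k.+1 + 1)%N by lia.
have nk1 : (n - k.+1 = 1 + (n - k.+2))%N by lia.
have nE2 : n = (k.+1 + 1 + (n - k.+2))%N by lia.
have EB : redB k.+1 sigma + redB k.+1 Q = redB k.+1 rho + redB k.+1 P.
  by rewrite -!redBD E.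
have mB' : ptr (@mixr 1 (n - k.+2) (n - k.+1)) (redB k.+1 rho) =
    ptr (@mixr 1 (n - k.+2) (n - k.+1)) (redB k.+1 sigma).
  by rewrite !redBE !(ptrr_ptrr _ k2 nk1 nE2) -!redBE mB.
have [b1 b2] := vN_entropy_gap (mixrK nk1) (unmixrK nk1) card2 (psd_redB k.+1 pr)
  (psd_redB k.+1 ps) (psd_redB k.+1 pP) (psd_redB k.+1 pQ) EB
  (etrans (congr1 _ (tr_redB _ k1n)) tr) (etrans (congr1 _ (tr_redB _ k1n)) ts)
  (etrans (congr1 _ (tr_redB _ k1n)) tP) (etrans (congr1 _ (tr_redB _ k1n)) tQ) mB'.
have -> : mutinfo k.+1 sigma - mutinfo k.+1 rho =
    (vN_entropy (redA k.+1 sigma) - vN_entropy (redA k.+1 rho)) +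
    (vN_entropy (redB k.+1 sigma) - vN_entropy (redB k.+1 rho)).
  rewrite /mutinfo.
  move: (vN_entropy sigma) (vN_entropy rho) SE => s r ->.
  move: (vN_entropy (redA _ _)) (vN_entropy (redB _ _)) => x y.
  move: (vN_entropy (redA _ _)) (vN_entropy (redB _ _)) => z t; ring.
move: a1 a2 b1 b2; move: (_ - _) (vN_entropy (redB _ _) - _) (hbin _) (ln 2).
clear=> x y h l a1 a2 b1 b2; have := ler_normD x y; split; lra.
Qed.

(** The constants 4, 4, 2 from the cut are enlarged to 8, 8, 3, all the terms being nonnegative. *)
Lemma le_min_gap_bound (nu d : R) : 0 <= nu -> d <= 4 * ln 2 ->
  d <= 4 * nu * ln 2 + 2 * (1 + nu) * hbin (nu / (1 + nu)) ->
  d <= Num.min (8 * ln 2) (8 * nu * ln 2 + 3 * (1 + nu) * hbin (nu / (1 + nu))).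
Proof.
move=> nu0; have l2 : 0 <= ln (2 : R) by apply: ln_ge0; lra.
have n1 : 0 < 1 + nu by lra.
have h0 : 0 <= hbin (nu / (1 + nu)).
  by apply: hbin_ge0; rewrite divr_ge0 ?(ltW n1) //= ler_pdivrMr // mul1r; lra.
have nl : 0 <= nu * ln 2 by rewrite mulr_ge0.
have nh : 0 <= (1 + nu) * hbin (nu / (1 + nu)) by rewrite mulr_ge0 // ltW.
by rewrite le_min => g1 g2; apply/andP; split; lra.
Qed.

End CutBounds.

Theorem theoremG1 (R : realType) (n : nat) (k : nat)
    (rho U : 'M[R[i]]_(2 ^ n)) (u : 'M[R[i]]_4) :
  (2 <= n)%N ->
  density rho ->
  unitary u ->
  (k + 2 <= n)%N ->
  U = embed2 n k u ->
  let nu := sin (Num.min (egate U) (pi / 2)) in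
  `| Echain (U *m rho *m adjmx U) - Echain rho |
    <= ((n - 1)%N%:R)^-1 *
       Num.min (8 * ln 2)
               (8 * nu * ln 2 + 3 * (1 + nu) * hbin (nu / (1 + nu))).
Proof.
move=> n2 [hrho prho trho] uu kn UE; cbv zeta; set nu := sin _.
have pr : psd rho by [].
have uU : unitary U by rewrite UE; exact: unitary_embed2.
have tr1 : complex.Re (\tr rho) = 1 by rewrite trho.
pose sigma := U *m rho *m adjmx U.
have ps : psd sigma by exact: psd_conj.
have ts : complex.Re (\tr sigma) = 1.
  by rewrite /sigma mxtrace_mulC mulmxA (unitary_adj uU) mul1mx.
have range psi := egate_numerical_range uU (psi := psi).
have nu0 : 0 <= nu.
  (* Any unit vector shows nu >= 0, since nu dominates a square root. *)
  pose e : 'cV[R[i]]_(2 ^ n) := delta_mx (Ordinal (expn_gt0 2 n)) 0.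
  have e1 : adjmx e *m e = 1%:M.
    apply/matrixP => i j; rewrite !ord1 mulmx_diag_adj [RHS]mxE mulr1n.
    rewrite (bigD1 (Ordinal (expn_gt0 2 n))) //= big1 => [|x xe].
      by rewrite mxE !eqxx addr0 sqn_real expr1n.
    by rewrite mxE (negPf xe) sqn_real expr0n.
  exact: le_trans (sqrtr_ge0 _) (range e e1).
have rangeU (psi : 'cV[R[i]]_(2 ^ n)) : adjmx psi *m psi = 1%:M ->
    1 - sqn ((adjmx psi *m U *m psi) 0 0) <= nu ^+ 2.
  move=> /range; set s := 1 - _ => h; have [s0|s0] := leP s 0.
    by rewrite (le_trans s0) // sqr_ge0.
  by rewrite -(sqr_sqrtr (ltW s0)) lerXn2r ?nnegrE ?sqrtr_ge0.
have [P [Q [pP pQ tP tQ E]]] := mixed_decomposition uU pr tr1 nu0 rangeU.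
(* At an end of the chain the untouched block is empty: its space has dimension one and the marginal
   is the trace. *)
have mA : redA k sigma = redA k rho.
  by rewrite /sigma UE; exact: redA_gate_right.
have mB : redB k.+2 sigma = redB k.+2 rho.
  by rewrite /sigma UE; apply: redB_gate_left => //; lia.
have SE : vN_entropy sigma = vN_entropy rho by exact: vN_entropy_conj.
have [g1 g2] := mutinfo_gap kn pr ps pP pQ E tr1 ts tP tQ mA mB SE.
have chain : Echain sigma - Echain rho =
    (n - 1)%N%:R^-1 * (mutinfo k.+1 sigma - mutinfo k.+1 rho).
  by rewrite /sigma UE; exact: Echain_gate.
have c0 : 0 <= (n - 1)%N%:R^-1 :> R by rewrite invr_ge0 ler0n.
rewrite -/sigma chain normrM (ger0_norm c0).
exact: (ler_wpM2l c0 (le_min_gap_bound nu0 g1 g2)).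
Qed.
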